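(* Let $\Phi$ be the standard normal CDF, $\bar\Phi=1-\Phi$. Let $\mu>0$ and $\epsilon\in(0,1)$ and define, for $x\in[0,1]$, \[ D(x)=(1-\epsilon)x+\epsilon\bigl(1-\Phi(\Phi^{-1}(1-x)-\mu)\bigr). \] For $\tau_1\in(0,1]$, $\tau_2>0$ define $E_0=\tau_1(1-\log\tau_1+\log\tau_2)$, $E_1=\int_0^{\tau_1}-\log(u/\tau_2)D'(u)\,du$, $\Delta=E_1-E_0$, \[ V_1=\int_0^{\tau_1}\log^2(u)D'(u)\,du-\Big(\int_0^{\tau_1}\log(u)D'(u)\,du\Big)^2+2(D(\tau_1)-1)\log(\tau_2)\int_0^{\tau_1}\log(u)D'(u)\,du+\log^2(\tau_2)D(\tau_1)(1-D(\tau_1)), \] and $b(\tau_1,\tau_2)=\Delta/\sqrt{V_1}$. For $k=1,2$ let $\tilde g_k(\mu)=\int_0^1\log^k(u)\bigl(e^{\mu\Phi^{-1}(1-u)-\mu^2/2}-1\bigr)\,du$. If $\mu>0.85$ and \[ \epsilon<h_b(\mu)=\frac{1+\tilde g_1(\mu)}{(\tilde g_1(\mu))^2-\tilde g_1(\mu)-\tilde g_2(\mu)}, \] then there exists $\tau^*$ such that $(\tau_1,\tau_2)=(\tau^*,\tau^* )$ is a stationary point of $b$, i.e. $\frac{\partial b}{\partial\tau_1}(\tau^*,\tau^* )=\frac{\partial b}{\partial\tau_2}(\tau^*,\tau^* )=0$.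
   Context: Signal detection setting: $H_0: X_i\overset{\text{i.i.d.}}{\sim}N(0,1)$ versus $H_1: X_i\overset{\text{i.i.d.}}{\sim}\epsilon N(\mu,1)+(1-\epsilon)N(0,1)$, $i=1,\dots,n$, with input $p$-values $P_i=\bar\Phi(X_i)$; then $D(x)=\bar F_1(\bar F_0^{-1}(x))$ with $F_0$, $F_1$ the null and alternative CDFs. The TFisher statistic is $W_n(\tau_1,\tau_2)=\sum_{i=1}^n\bigl(-2\log P_i+2\log\tau_2\bigr)I(P_i\le\tau_1)$. $E_0$ is the null mean and $E_1$, $V_1$ the alternative mean and variance of $-\log(P_i/\tau_2)I(P_i\le\tau_1)$; $b$ is called the Asymptotic Power Rate. The choice $\tau_1=\tau_2$ is called soft-thresholding. *)

(* Defs.v *)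
From Stdlib Require Import Reals ClassicalEpsilon.
From Coquelicot Require Import Coquelicot.
Open Scope R_scope.

Definition phi_dens (t : R) : R := exp (- t ^ 2 / 2) / sqrt (2 * PI).
Definition Phi (x : R) : R := RInt_gen phi_dens (Rbar_locally m_infty) (at_point x).
(* Phi^{-1}(p): the (unique, for 0<p<1) x with Phi x = p *)
Definition Phi_inv (p : R) : R := epsilon (inhabits 0) (fun x => Phi x = p).

Definition D (mu eps x : R) : R :=
  (1 - eps) * x + eps * (1 - Phi (Phi_inv (1 - x) - mu)).
Definition Dp (mu eps u : R) : R := Derive (D mu eps) u.

Definition I0 (f : R -> R) (t1 : R) : R := RInt_gen f (at_right 0) (at_point t1).

Definition E0 (t1 t2 : R) : R := t1 * (1 - ln t1 + ln t2).
Definition E1 (mu eps t1 t2 : R) : R :=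
  I0 (fun u => - ln (u / t2) * Dp mu eps u) t1.
Definition Delta (mu eps t1 t2 : R) : R := E1 mu eps t1 t2 - E0 t1 t2.
Definition V1 (mu eps t1 t2 : R) : R :=
  let L1 := I0 (fun u => ln u * Dp mu eps u) t1 in
  let L2 := I0 (fun u => (ln u) ^ 2 * Dp mu eps u) t1 in
  L2 - L1 ^ 2 + 2 * (D mu eps t1 - 1) * ln t2 * L1
  + (ln t2) ^ 2 * D mu eps t1 * (1 - D mu eps t1).
Definition b (mu eps t1 t2 : R) : R := Delta mu eps t1 t2 / sqrt (V1 mu eps t1 t2).

Definition g_tilde (k : nat) (mu : R) : R :=
  RInt_gen (fun u => (ln u) ^ k * (exp (mu * Phi_inv (1 - u) - mu ^ 2 / 2) - 1))
    (at_right 0) (at_left 1).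
Definition h_b (mu : R) : R :=
  (1 + g_tilde 1 mu) / ((g_tilde 1 mu) ^ 2 - g_tilde 1 mu - g_tilde 2 mu).

(* Main.v *)
(* On the diagonal t1 = t2 = t both the numerator and the variance of b are stationary in t1, so only the
   derivative in t2 matters.  With A = -ln (P / t) restricted to P <= t and its moments m1, m2 under the
   alternative, that derivative vanishes iff f(t) = (D - t)(m2 - m1^2) - (m1 - t)(1 - D) m1 does.
   - f > 0 somewhere: D is concave, so m1 >= D and m2 >= 2 m1, and f > 0 as soon as m1 < 2 D - t, which
     holds for some t because D(t) = O(t^(3/4)) at 0.
   - f < 0 near 1: f(t) / (1 - t) tends to eps (1 + g1 + eps (g2 + g1 - g1^2)), which is negative when
     1 + g1 < 0 and eps < h_b.
   The condition 1 + g1 < 0 says that -ln P has mean > 2 under N(mu,1); by monotonicity mu = 0.85 suffices,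
   where the mean is only 2.002.  It is bounded below by integrating
     -ln r >= 1 + q + ln M - r exp(q) M,   r = 1 - Phi(z + 0.85),
   with q quadratic and M a quadratic polynomial: the last term is a two-dimensional Gaussian integral,
   controlled by differentiating in the shift 0.85. *)

From Stdlib Require Import Reals Lra Lia ClassicalEpsilon Ranalysis5 Machin.
From Coquelicot Require Import Coquelicot.
Require Import Defs.
Open Scope R_scope.

(** The minorant of -ln r is exact where exp(q) M = 1/r, so its quality is that of the approximation
    of 1/r by a Gaussian factor times a polynomial. In the end a Gaussian mean above 3.0003 is set
    against an integral below 1.0002, which leaves a margin of 0.0001 over the threshold 2.
    Differentiating in the shift replaces the tail 1 - Phi by a density and makes the integrand
    purely Gaussian; integrating back only needs an upper bound for Mills' ratio. The other
    constraint comes from [Phi_inv]: it is a choice operator, specified only on the open unit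
    interval, so [D] and its derivative are not evaluated at 0 or 1. Integrals are therefore handled
    through primitives on the open interval that vanish at 0, and quantities at 1 are one-sided
    limits, whose existence follows from monotonicity. Apart from the lower bound on the first of
    them, these limits stay abstract. *)

Lemma le_of_derive_nonneg (f df : R -> R) (a b : R) :
  a <= b ->
  (forall x, a <= x <= b -> is_derive f x (df x)) ->
  (forall x, a <= x <= b -> 0 <= df x) -> f a <= f b.
Proof.
intros Hab Hd Hp.
destruct (MVT_gen f a b df) as [c [Hc E]].
- intros x Hx. rewrite Rmin_left, Rmax_right in Hx by lra. apply Hd; lra.
- intros x Hx. rewrite Rmin_left, Rmax_right in Hx by lra.
  apply continuity_pt_filterlim.
  apply (ex_derive_continuous (K := R_AbsRing) (V := R_NormedModule) f x). exists (df x); apply Hd; lra.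
- rewrite Rmin_left, Rmax_right in Hc by lra.
  specialize (Hp c Hc). nra.
Qed.

Lemma ln_neg (x : R) : 0 < x -> x < 1 -> ln x < 0.
Proof. intros H0 H1. rewrite <- ln_1. now apply ln_increasing. Qed.

(** * The normal distribution function *)

Lemma sqrt_2PI_pos : 0 < sqrt (2 * PI).
Proof. apply sqrt_lt_R0. generalize PI_RGT_0; lra. Qed.

Lemma phi_dens_pos (t : R) : 0 < phi_dens t.
Proof. apply Rdiv_lt_0_compat; [apply exp_pos | apply sqrt_2PI_pos]. Qed.

Lemma is_derive_phi_dens (t : R) : is_derive phi_dens t (- t * phi_dens t).
Proof.
unfold phi_dens. generalize sqrt_2PI_pos; intros H.
auto_derive; [easy | unfold Rdiv; simpl; field; lra].
Qed.

Lemma continuous_phi_dens (t : R) : continuous phi_dens t.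
Proof.
apply (ex_derive_continuous (K := R_AbsRing) (V := R_NormedModule)).
exists (- t * phi_dens t). apply is_derive_phi_dens.
Qed.

Lemma phi_dens_opp (t : R) : phi_dens (- t) = phi_dens t.
Proof. unfold phi_dens. do 2 f_equal. field. Qed.

Lemma ex_RInt_phi_dens (a b : R) : ex_RInt phi_dens a b.
Proof. apply (ex_RInt_continuous (V := R_CompleteNormedModule)). intros; apply continuous_phi_dens. Qed.

(** * The Gaussian integral *)

Definition half_gauss (x : R) : R := RInt (fun r => exp (- r ^ 2 / 2)) 0 x.

Lemma continuous_gauss (r : R) : continuous (fun r => exp (- r ^ 2 / 2)) r.
Proof.
apply (ex_derive_continuous (K := R_AbsRing) (V := R_NormedModule)). auto_derive; easy.
Qed.

Lemma is_derive_half_gauss (x : R) : is_derive half_gauss x (exp (- x ^ 2 / 2)).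
Proof.
apply (is_derive_RInt (V := R_NormedModule) (fun r => exp (- r ^ 2 / 2)) half_gauss 0 x).
- apply filter_forall; intros y. unfold half_gauss.
  apply (RInt_correct (V := R_CompleteNormedModule)).
  apply (ex_RInt_continuous (V := R_CompleteNormedModule)).
  intros; apply continuous_gauss.
- apply continuous_gauss.
Qed.

(* The sum [half_gauss x ^ 2 + 2 * gauss_aux x] is constant: this evaluates the Gaussian integral
   without polar coordinates. *)
Definition gauss_aux (x : R) : R :=
  RInt (fun t => exp (- x ^ 2 * (1 + t ^ 2) / 2) / (1 + t ^ 2)) 0 1.

Lemma is_derive_gauss_aux (x : R) :
  is_derive gauss_aux x (- exp (- x ^ 2 / 2) * half_gauss x).
Proof.
assert (Hpos : forall t : R, 1 + t ^ 2 <> 0) by (intros; nra).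
assert (Hd : forall x t, is_derive (fun x => exp (- x ^ 2 * (1 + t ^ 2) / 2) / (1 + t ^ 2)) x
   (- x * exp (- x ^ 2 * (1 + t ^ 2) / 2))).
{ intros y t. specialize (Hpos t). auto_derive; [easy | unfold Rdiv; simpl in *; field; nra]. }
replace (- exp (- x ^ 2 / 2) * half_gauss x) with
  (RInt (fun t => Derive (fun u => exp (- u ^ 2 * (1 + t ^ 2) / 2) / (1 + t ^ 2)) x) 0 1).
- apply (is_derive_RInt_param (fun x t => exp (- x ^ 2 * (1 + t ^ 2) / 2) / (1 + t ^ 2)) 0 1 x).
  + apply filter_forall. intros y t _. eexists; apply Hd.
  + intros t _.
    apply (continuity_2d_pt_ext (fun u v => - u * exp (- (u ^ 2 * (1 + v ^ 2)) * / 2))).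
    { intros u v. symmetry. etransitivity; [apply is_derive_unique, Hd|].
      do 2 f_equal. unfold Rdiv; ring. }
    assert (Hsq : forall (f : R -> R -> R) x y, continuity_2d_pt f x y ->
       continuity_2d_pt (fun u v => f u v ^ 2) x y).
    { intros f a b Hf. apply continuity_2d_pt_ext with (fun u v => f u v * f u v).
      intros; ring. now apply continuity_2d_pt_mult. }
    apply continuity_2d_pt_mult.
    * apply continuity_2d_pt_opp, continuity_2d_pt_id1.
    * apply (continuity_1d_2d_pt_comp exp).
      apply derivable_continuous_pt, derivable_pt_exp.
      apply continuity_2d_pt_mult; [|apply continuity_2d_pt_const].
      apply continuity_2d_pt_opp, continuity_2d_pt_mult.
      apply Hsq, continuity_2d_pt_id1.
      apply continuity_2d_pt_plus; [apply continuity_2d_pt_const|].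
      apply Hsq, continuity_2d_pt_id2.
  + apply filter_forall. intros y.
    apply (ex_RInt_continuous (V := R_CompleteNormedModule)).
    intros t _. apply (ex_derive_continuous (K := R_AbsRing) (V := R_NormedModule)).
    auto_derive. generalize (Hpos t); simpl; auto.
(* The exponential splits into two factors; [x * t + 0] is the affine form expected by
   [RInt_comp_lin], and substituting r = x t produces [half_gauss x], also for x = 0. *)
- rewrite (RInt_ext _ (fun t => scal (- exp (- x ^ 2 / 2)) (scal x ((fun r => exp (- r ^ 2 / 2)) (x * t + 0))))).
  2:{ intros t _. etransitivity; [apply is_derive_unique, Hd|]. unfold scal; simpl; unfold mult; simpl.
      replace (- (x * (x * 1)) * (1 + t * (t * 1)) / 2) with
        (- (x * (x * 1)) / 2 + - ((x * t + 0) * ((x * t + 0) * 1)) / 2) by field.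
      rewrite exp_plus. ring. }
  assert (Hi : ex_RInt (fun y => scal x ((fun r => exp (- r ^ 2 / 2)) (x * y + 0))) 0 1).
  { apply (ex_RInt_comp_lin (V := R_NormedModule) (fun r => exp (- r ^ 2 / 2)) x 0 0 1).
    apply (ex_RInt_continuous (V := R_CompleteNormedModule)). intros; apply continuous_gauss. }
  rewrite (RInt_scal (V := R_CompleteNormedModule)) by exact Hi.
  transitivity (scal (- exp (- x ^ 2 / 2)) (RInt (fun r => exp (- r ^ 2 / 2)) (x * 0 + 0) (x * 1 + 0))).
  + apply f_equal.
    apply (RInt_comp_lin (V := R_CompleteNormedModule) (fun r => exp (- r ^ 2 / 2)) x 0 0 1).
    apply (ex_RInt_continuous (V := R_CompleteNormedModule)). intros; apply continuous_gauss.
  + unfold half_gauss. replace (x * 0 + 0) with 0 by ring. replace (x * 1 + 0) with x by ring. reflexivity.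
Qed.

Lemma gauss_aux_0 : gauss_aux 0 = PI / 4.
Proof.
unfold gauss_aux.
rewrite (RInt_ext _ (fun t => / (1 + t ^ 2))).
2:{ intros t _. replace (- 0 ^ 2 * (1 + t ^ 2) / 2) with 0 by (unfold Rdiv; ring). rewrite exp_0. apply Rmult_1_l. }
rewrite <- atan_1.
apply (is_RInt_unique (V := R_CompleteNormedModule)).
replace (atan 1) with (minus (atan 1) (atan 0)).
2:{ rewrite atan_0. unfold minus, plus, opp; simpl; ring. }
apply (is_RInt_derive (V := R_CompleteNormedModule) atan).
- intros t _. apply is_derive_Reals.
  apply derivable_pt_lim_atan.
- intros t _. apply (ex_derive_continuous (K := R_AbsRing) (V := R_NormedModule)).
  auto_derive. nra.
Qed.

Lemma gauss_aux_bounds (x : R) : 0 <= gauss_aux x <= exp (- x ^ 2 / 2).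
Proof.
assert (Hi : ex_RInt (fun t => exp (- x ^ 2 * (1 + t ^ 2) / 2) / (1 + t ^ 2)) 0 1).
{ apply (ex_RInt_continuous (V := R_CompleteNormedModule)). intros t _.
  apply (ex_derive_continuous (K := R_AbsRing) (V := R_NormedModule)). auto_derive. nra. }
split.
- apply RInt_ge_0; [lra | exact Hi |]. intros t _.
  apply Rlt_le, Rdiv_lt_0_compat; [apply exp_pos | nra].
- replace (exp (- x ^ 2 / 2)) with (RInt (fun _ => exp (- x ^ 2 / 2)) 0 1).
  2:{ rewrite RInt_const. unfold scal; simpl; unfold mult; simpl. ring. }
  apply RInt_le; [lra | exact Hi | apply (ex_RInt_const (V:=R_NormedModule)) |].
  intros t _.
  assert (H1 : exp (- x ^ 2 * (1 + t ^ 2) / 2) <= exp (- x ^ 2 / 2)).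
  { assert (H := pow2_ge_0 (x * t)).
    destruct (Req_dec (x * t) 0) as [E|E].
    - apply Req_le. f_equal. replace (- x ^ 2 * (1 + t ^ 2) / 2) with (- x ^ 2 / 2 - (x * t) ^ 2 / 2) by field.
      rewrite E. field.
    - apply Rlt_le, exp_increasing.
      assert (0 < (x * t) ^ 2) by (apply pow2_gt_0; auto). nra. }
  apply Rle_trans with (2 := H1).
  apply Rmult_le_reg_r with (1 + t ^ 2); [nra|].
  unfold Rdiv. rewrite Rmult_assoc, Rinv_l by nra.
  generalize (exp_pos (- x ^ 2 * (1 + t ^ 2) / 2)). nra.
Qed.

Lemma half_gauss_sqr (x : R) : half_gauss x ^ 2 = PI / 2 - 2 * gauss_aux x.
Proof.
set (H := fun x => half_gauss x ^ 2 + 2 * gauss_aux x).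
assert (Hd : forall x, is_derive H x 0).
{ intros y. unfold H.
  evar_last.
  apply (is_derive_plus (K := R_AbsRing) (V := R_NormedModule)).
  apply is_derive_pow, is_derive_half_gauss.
  apply is_derive_scal, is_derive_gauss_aux.
  unfold plus; simpl. ring. }
assert (E : H x = H 0).
{ destruct (MVT_gen H 0 x (fun _ => 0)) as [c [_ E]].
  - intros; apply Hd.
  - intros y _. apply continuity_pt_filterlim.
    apply (ex_derive_continuous (K := R_AbsRing) (V := R_NormedModule)). exists 0; apply Hd.
  - lra. }
unfold H in E. rewrite gauss_aux_0 in E.
assert (Z : half_gauss 0 = 0).
{ unfold half_gauss. rewrite RInt_point. reflexivity. }
rewrite Z in E. lra.
Qed.

Lemma exp_opp_half_sqr_le (x : R) : 0 < x -> exp (- x ^ 2 / 2) <= / x.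
Proof.
intros Hx. replace (- x ^ 2 / 2) with (- (x ^ 2 / 2)) by field. rewrite exp_Ropp.
apply Rinv_le_contravar; [exact Hx|].
generalize (exp_ineq1_le (x ^ 2 / 2)). nra.
Qed.

Lemma half_gauss_nonneg (x : R) : 0 <= x -> 0 <= half_gauss x.
Proof.
intros Hx. apply RInt_ge_0; [exact Hx | |intros; apply Rlt_le, exp_pos].
apply (ex_RInt_continuous (V := R_CompleteNormedModule)). intros; apply continuous_gauss.
Qed.

Lemma is_lim_half_gauss : is_lim half_gauss p_infty (sqrt (PI / 2)).
Proof.
apply is_lim_ext_loc with (fun x => sqrt (PI / 2 - 2 * gauss_aux x)).
{ exists 0. intros x Hx. rewrite <- half_gauss_sqr. apply sqrt_pow2, half_gauss_nonneg; lra. }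
apply (is_lim_comp_continuous (fun x => PI / 2 - 2 * gauss_aux x) sqrt p_infty (PI / 2)).
2:{ apply continuity_pt_filterlim, continuity_pt_sqrt. generalize PI_RGT_0; lra. }
replace (Finite (PI / 2)) with (Finite (PI / 2 - 2 * 0)) by (f_equal; ring).
assert (G : is_lim gauss_aux p_infty 0).
{ apply (is_lim_le_le_loc (fun _ => 0) (fun x => / x)).
  - exists 0. intros x Hx. generalize (gauss_aux_bounds x) (exp_opp_half_sqr_le x Hx). lra.
  - apply is_lim_const.
  - replace (Finite 0) with (Rbar_inv p_infty) by reflexivity.
    apply is_lim_inv; [apply is_lim_id | easy]. }
apply (is_lim_minus' (fun _ => PI / 2) (fun x => 2 * gauss_aux x)).
- apply is_lim_const.
- apply (is_lim_scal_l _ 2 p_infty 0 G).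
Qed.

Lemma RInt_phi_dens_0 (x : R) : RInt phi_dens 0 x = half_gauss x / sqrt (2 * PI).
Proof.
unfold half_gauss.
rewrite (RInt_ext phi_dens (fun r => scal (/ sqrt (2 * PI)) (exp (- r ^ 2 / 2)))).
2:{ intros; unfold phi_dens, scal; simpl; unfold mult; simpl. unfold Rdiv; ring. }
rewrite (RInt_scal (V := R_CompleteNormedModule)).
- unfold scal; simpl; unfold mult; simpl. unfold Rdiv; ring.
- apply (ex_RInt_continuous (V := R_CompleteNormedModule)). intros; apply continuous_gauss.
Qed.

Lemma is_lim_RInt_phi_dens : is_lim (fun x => RInt phi_dens 0 x) p_infty (1 / 2).
Proof.
apply is_lim_ext with (fun x => half_gauss x * / sqrt (2 * PI)).
{ intros; now rewrite RInt_phi_dens_0. }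
replace (Finite (1 / 2)) with (Rbar_mult (sqrt (PI / 2)) (/ sqrt (2 * PI))).
- apply is_lim_scal_r, is_lim_half_gauss.
- simpl. f_equal. generalize sqrt_2PI_pos PI_RGT_0; intros H1 H2.
  replace (2 * PI) with (PI / 2 * (2 * 2)) by field.
  rewrite sqrt_mult by lra. rewrite sqrt_square by lra.
  assert (0 < sqrt (PI / 2)) by (apply sqrt_lt_R0; lra). field. lra.
Qed.

Lemma RInt_phi_dens_opp (x : R) : RInt phi_dens 0 (- x) = - RInt phi_dens 0 x.
Proof.
assert (H : is_RInt phi_dens (- 0) (- x) (RInt phi_dens 0 (- x))).
{ rewrite Ropp_0. apply (RInt_correct (V := R_CompleteNormedModule)), ex_RInt_phi_dens. }
apply (is_RInt_comp_opp (V := R_NormedModule)) in H.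
apply (is_RInt_unique (V := R_CompleteNormedModule)) in H. rewrite <- H.
apply (is_RInt_unique (V := R_CompleteNormedModule)).
apply (is_RInt_ext (fun y => opp (phi_dens y))).
{ intros; now rewrite phi_dens_opp. }
apply (is_RInt_opp (V := R_NormedModule)), (RInt_correct (V := R_CompleteNormedModule)), ex_RInt_phi_dens.
Qed.

(** The primitive of [phi_dens] from 0 is odd and tends to 1/2 at infinity, hence to -1/2 at minus
    infinity. From here on [Phi] is an ordinary integral plus a constant. *)
Lemma Phi_RInt (x : R) : Phi x = 1 / 2 + RInt phi_dens 0 x.
Proof.
unfold Phi. apply is_RInt_gen_unique.
apply (is_RInt_gen_ext (Derive (fun y => RInt phi_dens 0 y))).
{ apply filter_forall. intros [a c] y _. apply is_derive_unique.
  apply (is_derive_RInt (V := R_NormedModule) phi_dens _ 0).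
  apply filter_forall; intros z. apply (RInt_correct (V := R_CompleteNormedModule)), ex_RInt_phi_dens.
  apply continuous_phi_dens. }
replace (1 / 2 + RInt phi_dens 0 x) with (RInt phi_dens 0 x - - (1 / 2)) by ring.
assert (Hd : forall y, is_derive (fun y => RInt phi_dens 0 y) y (phi_dens y)).
{ intros y. apply (is_derive_RInt (V := R_NormedModule) phi_dens _ 0).
  apply filter_forall; intros z. apply (RInt_correct (V := R_CompleteNormedModule)), ex_RInt_phi_dens.
  apply continuous_phi_dens. }
apply is_RInt_gen_Derive.
- apply filter_forall. intros [a c] y _. eexists; apply Hd.
- apply filter_forall. intros [a c] y _.
  apply continuous_ext with phi_dens; [|apply continuous_phi_dens].
  intros z. symmetry. apply is_derive_unique, Hd.
- apply (filterlim_ext (fun y => - RInt phi_dens 0 (- y))).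
  { intros y. rewrite RInt_phi_dens_opp. apply Ropp_involutive. }
  apply (is_lim_opp (fun y => RInt phi_dens 0 (- y)) m_infty (1 / 2)).
  apply (is_lim_comp (fun y => RInt phi_dens 0 y) Ropp m_infty (1 / 2) p_infty).
  + apply is_lim_RInt_phi_dens.
  + apply (is_lim_opp (fun y => y) m_infty m_infty), is_lim_id.
  + exists 0. easy.
- intros P [e He]. apply He. apply ball_center.
Qed.

Lemma is_derive_Phi (x : R) : is_derive Phi x (phi_dens x).
Proof.
apply is_derive_ext with (fun x => 1 / 2 + RInt phi_dens 0 x).
{ intros; now rewrite Phi_RInt. }
evar_last.
apply (is_derive_plus (K := R_AbsRing) (V := R_NormedModule)).
apply is_derive_const.
apply (is_derive_RInt (V := R_NormedModule) phi_dens _ 0).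
apply filter_forall; intros z. apply (RInt_correct (V := R_CompleteNormedModule)), ex_RInt_phi_dens.
apply continuous_phi_dens.
apply plus_zero_l.
Qed.

Lemma continuous_Phi (x : R) : continuous Phi x.
Proof.
apply (ex_derive_continuous (K := R_AbsRing) (V := R_NormedModule)).
eexists; apply is_derive_Phi.
Qed.

Lemma Phi_increasing (x y : R) : x < y -> Phi x < Phi y.
Proof.
intros H.
destruct (MVT_gen Phi x y phi_dens) as [c [_ E]].
- intros; apply is_derive_Phi.
- intros z _. apply continuity_pt_filterlim, continuous_Phi.
- generalize (phi_dens_pos c). nra.
Qed.

Lemma Phi_opp (x : R) : Phi (- x) = 1 - Phi x.
Proof. rewrite !Phi_RInt, RInt_phi_dens_opp. lra. Qed.

Lemma is_lim_Phi_p_infty : is_lim Phi p_infty 1.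
Proof.
apply is_lim_ext with (fun x => 1 / 2 + RInt phi_dens 0 x).
{ intros; now rewrite Phi_RInt. }
replace (Finite 1) with (Finite (1 / 2 + 1 / 2)) by (f_equal; field).
apply (is_lim_plus' (fun _ => 1 / 2) (fun x => RInt phi_dens 0 x)).
apply is_lim_const. apply is_lim_RInt_phi_dens.
Qed.

Lemma is_lim_Phi_m_infty : is_lim Phi m_infty 0.
Proof.
apply is_lim_ext with (fun x => 1 - Phi (- x)).
{ intros x. rewrite Phi_opp. ring. }
replace (Finite 0) with (Finite (1 - 1)) by (f_equal; ring).
apply (is_lim_minus' (fun _ => 1) (fun x => Phi (- x))).
- apply is_lim_const.
- apply (is_lim_comp Phi Ropp m_infty 1 p_infty).
  + apply is_lim_Phi_p_infty.
  + apply (is_lim_opp (fun y => y) m_infty m_infty), is_lim_id.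
  + exists 0. easy.
Qed.

Lemma Phi_lt_1 (x : R) : Phi x < 1.
Proof.
apply Rlt_le_trans with (Phi (x + 1)); [apply Phi_increasing; lra|].
apply (is_lim_le_loc (fun _ => Phi (x + 1)) Phi p_infty (Phi (x + 1)) 1).
- exists (x + 1). intros y Hy. apply Rlt_le, Phi_increasing, Hy.
- apply is_lim_const.
- apply is_lim_Phi_p_infty.
Qed.

Lemma Phi_pos (x : R) : 0 < Phi x.
Proof. generalize (Phi_lt_1 (- x)). rewrite Phi_opp. lra. Qed.

(** * The normal quantile function *)

(** The intermediate value theorem supplies the preimage that the choice operator needs in order to
    mean anything. *)
Lemma Phi_Phi_inv (p : R) : 0 < p < 1 -> Phi (Phi_inv p) = p.
Proof.
intros Hp. unfold Phi_inv. apply epsilon_spec.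
destruct (IVT_Rbar_incr Phi m_infty p_infty 0 1 p) as [x [_ [_ Hx]]]; try easy.
- apply is_lim_Phi_m_infty.
- apply is_lim_Phi_p_infty.
- intros x _ _. apply continuity_pt_filterlim, continuous_Phi.
- now exists x.
Qed.

Lemma Phi_inv_lt (p x : R) : 0 < p < 1 -> p < Phi x -> Phi_inv p < x.
Proof.
intros Hp Hx. destruct (Rlt_or_le (Phi_inv p) x) as [H|H]; [exact H|].
rewrite <- (Phi_Phi_inv p Hp) in Hx. destruct H as [H|H].
- apply Phi_increasing in H. lra.
- rewrite H in Hx. lra.
Qed.

Lemma Phi_inv_gt (p x : R) : 0 < p < 1 -> Phi x < p -> x < Phi_inv p.
Proof.
intros Hp Hx. destruct (Rlt_or_le x (Phi_inv p)) as [H|H]; [exact H|].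
rewrite <- (Phi_Phi_inv p Hp) in Hx. destruct H as [H|H].
- apply Phi_increasing in H. lra.
- rewrite H in Hx. lra.
Qed.

Lemma Phi_inv_increasing (p r : R) : 0 < p < 1 -> 0 < r < 1 -> p < r -> Phi_inv p < Phi_inv r.
Proof. intros Hp Hr H. apply Phi_inv_lt; [exact Hp|]. now rewrite Phi_Phi_inv. Qed.

Lemma locally_open_interval (a b x : R) : a < x < b -> locally x (fun y => a < y < b).
Proof.
intros H. apply (open_and (fun y => a < y) (fun y => y < b)).
apply open_gt. apply open_lt. exact H.
Qed.

Lemma continuous_Phi_inv (p : R) : 0 < p < 1 -> continuous Phi_inv p.
Proof.
intros Hp. apply filterlim_locally. intros e.
assert (He := cond_pos e).
assert (H : locally p (fun y => Rmax 0 (Phi (Phi_inv p - e)) < y < Rmin 1 (Phi (Phi_inv p + e)))).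
{ apply locally_open_interval. split.
  - apply Rmax_lub_lt; [apply Hp|]. rewrite <- (Phi_Phi_inv p Hp) at 2. apply Phi_increasing; lra.
  - apply Rmin_glb_lt; [apply Hp|]. rewrite <- (Phi_Phi_inv p Hp) at 1. apply Phi_increasing; lra. }
revert H. apply filter_imp. intros y [H1 H2].
assert (Y : 0 < y < 1).
{ generalize (Rmax_l 0 (Phi (Phi_inv p - e))) (Rmin_l 1 (Phi (Phi_inv p + e))). lra. }
assert (Phi_inv p - e < Phi_inv y).
{ apply Phi_inv_gt; [exact Y|]. generalize (Rmax_r 0 (Phi (Phi_inv p - e))); lra. }
assert (Phi_inv y < Phi_inv p + e).
{ apply Phi_inv_lt; [exact Y|]. generalize (Rmin_r 1 (Phi (Phi_inv p + e))); lra. }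
unfold ball; simpl; unfold AbsRing_ball, abs, minus, plus, opp; simpl.
apply Rabs_def1; lra.
Qed.

Lemma is_derive_Phi_inv (p : R) : 0 < p < 1 -> is_derive Phi_inv p (/ phi_dens (Phi_inv p)).
Proof.
intros Hp. apply is_derive_Reals.
(* The inverse function theorem is stated on a compact interval; [p/2, (1+p)/2] is one inside (0,1)
   with p in its interior. *)
assert (Prf : forall a, Phi_inv (p / 2) <= a <= Phi_inv ((1 + p) / 2) -> derivable_pt Phi a).
{ intros a _. exists (phi_dens a). apply is_derive_Reals, is_derive_Phi. }
assert (Hi : Phi_inv (p / 2) <= Phi_inv p <= Phi_inv ((1 + p) / 2)).
{ split; apply Rlt_le, Phi_inv_increasing; lra. }
assert (E : derive_pt Phi (Phi_inv p) (Prf _ Hi) = phi_dens (Phi_inv p)).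
{ apply derive_pt_eq_0, is_derive_Reals, is_derive_Phi. }
generalize (derivable_pt_lim_recip_interv Phi Phi_inv (p / 2) ((1 + p) / 2) p Prf).
intros H.
replace (/ phi_dens (Phi_inv p)) with (1 / derive_pt Phi (Phi_inv p) (Prf _ Hi)).
2:{ rewrite E. unfold Rdiv; ring. }
apply H; try lra.
- apply continuity_pt_filterlim, continuous_Phi_inv, Hp.
- intros y Hy. unfold comp, id. apply Phi_Phi_inv. lra.
- rewrite E. generalize (phi_dens_pos (Phi_inv p)); lra.
Qed.

(** The inverse of the survival function: the observation whose p-value is [u]. *)
Definition upper_quantile (u : R) : R := Phi_inv (1 - u).

Lemma Phi_upper_quantile (u : R) : 0 < u < 1 -> Phi (upper_quantile u) = 1 - u.
Proof. intros; apply Phi_Phi_inv; lra. Qed.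

Lemma upper_quantile_decreasing (u v : R) :
  0 < u -> u < v -> v < 1 -> upper_quantile v < upper_quantile u.
Proof. intros; apply Phi_inv_increasing; lra. Qed.

Lemma is_derive_upper_quantile (u : R) :
  0 < u < 1 -> is_derive upper_quantile u (- / phi_dens (upper_quantile u)).
Proof.
intros Hu. unfold upper_quantile.
evar_last.
apply (is_derive_comp Phi_inv (fun u => 1 - u)).
- apply is_derive_Phi_inv; lra.
- apply (is_derive_minus (fun _ => 1) (fun u => u)); [apply is_derive_const | apply is_derive_id].
- unfold scal, minus, plus, opp, zero, one; simpl; unfold mult; simpl. ring.
Qed.

Lemma at_right_0_open_unit : at_right 0 (fun u => 0 < u < 1).
Proof.
exists (mkposreal 1 Rlt_0_1). intros y Hy Hy0.
unfold ball in Hy; simpl in Hy; unfold AbsRing_ball, abs, minus, plus, opp in Hy; simpl in Hy.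
apply Rabs_def2 in Hy. lra.
Qed.

Lemma at_left_1_open_unit : at_left 1 (fun u => 0 < u < 1).
Proof.
exists (mkposreal 1 Rlt_0_1). intros y Hy Hy0.
unfold ball in Hy; simpl in Hy; unfold AbsRing_ball, abs, minus, plus, opp in Hy; simpl in Hy.
apply Rabs_def2 in Hy. lra.
Qed.

Lemma at_right_lt (a c : R) : a < c -> at_right a (fun u => a < u < c).
Proof.
intros H. assert (Hc : 0 < c - a) by lra. exists (mkposreal _ Hc). intros y Hy Hy0.
unfold ball in Hy; simpl in Hy; unfold AbsRing_ball, abs, minus, plus, opp in Hy; simpl in Hy.
apply Rabs_def2 in Hy. lra.
Qed.

Lemma at_left_gt (c b : R) : c < b -> at_left b (fun u => c < u < b).
Proof.
intros H. assert (Hc : 0 < b - c) by lra. exists (mkposreal _ Hc). intros y Hy Hy0.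
unfold ball in Hy; simpl in Hy; unfold AbsRing_ball, abs, minus, plus, opp in Hy; simpl in Hy.
apply Rabs_def2 in Hy. lra.
Qed.

Lemma filterlim_upper_quantile_0 : filterlim upper_quantile (at_right 0) (Rbar_locally p_infty).
Proof.
intros P [M HM]. unfold filtermap.
assert (H := at_right_lt 0 (1 - Phi M)).
assert (L := Phi_lt_1 M). assert (L0 := Phi_pos M).
eapply filter_imp; [|apply H; lra].
intros u Hu. apply HM. apply Phi_inv_gt; lra.
Qed.

Lemma filterlim_upper_quantile_1 : filterlim upper_quantile (at_left 1) (Rbar_locally m_infty).
Proof.
intros P [M HM]. unfold filtermap.
assert (H := at_left_gt (1 - Phi M) 1).
assert (L := Phi_lt_1 M). assert (L0 := Phi_pos M).
eapply filter_imp; [|apply H; lra].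
intros u Hu. apply HM. apply Phi_inv_lt; lra.
Qed.

(** * Improper integrals on the unit interval *)

(** The endpoint filters are left arbitrary so that one statement serves both [I0], whose upper end
    is a point, and [g_tilde], whose upper end is [at_left 1]. *)
Lemma is_RInt_gen_primitive_open_unit (Fa Fb : (R -> Prop) -> Prop)
  (FFa : Filter Fa) (FFb : Filter Fb) (f F : R -> R) (la lb : R) :
  Fa (fun u => 0 < u < 1) -> Fb (fun u => 0 < u < 1) ->
  (forall u, 0 < u < 1 -> is_derive F u (f u)) ->
  (forall u, 0 < u < 1 -> continuous f u) ->
  filterlim F Fa (locally la) -> filterlim F Fb (locally lb) ->
  is_RInt_gen f Fa Fb (lb - la).
Proof.
intros Ha Hb Hd Hc La Lb.
assert (Hin : filter_prod Fa Fb (fun ab => forall x, Rmin (fst ab) (snd ab) <= x <= Rmax (fst ab) (snd ab) -> 0 < x < 1)).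
{ exists (fun u => 0 < u < 1) (fun u => 0 < u < 1); try assumption.
  intros x y Hx Hy z. simpl. intros Hz.
  generalize (Rmin_glb_lt x y 0) (Rmax_lub_lt x y 1). lra. }
apply (is_RInt_gen_ext (Derive F)).
{ revert Hin. apply filter_imp. intros [x y] H z Hz. apply is_derive_unique, Hd, H. simpl in *; lra. }
apply is_RInt_gen_Derive; try assumption.
- revert Hin. apply filter_imp. intros [x y] H z Hz. eexists; apply Hd, H, Hz.
- revert Hin. apply filter_imp. intros [x y] H z Hz.
  apply (continuous_ext_loc _ f).
  + generalize (locally_open_interval 0 1 z (H z Hz)). apply filter_imp.
    intros t Ht. symmetry. apply is_derive_unique, Hd, Ht.
  + apply Hc, H, Hz.
Qed.

Lemma I0_primitive (f F : R -> R) (t : R) :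
  0 < t < 1 ->
  (forall u, 0 < u < 1 -> is_derive F u (f u)) ->
  (forall u, 0 < u < 1 -> continuous f u) ->
  filterlim F (at_right 0) (locally 0) -> I0 f t = F t.
Proof.
intros Ht Hd Hc L. unfold I0. apply is_RInt_gen_unique.
replace (F t) with (F t - 0) by ring.
apply (is_RInt_gen_primitive_open_unit (at_right 0) (at_point t) _ _ f F 0 (F t)); try assumption.
- apply at_right_0_open_unit.
- intros P [e He]. apply He, ball_center.
Qed.

Lemma filterlim_at_left_nondecreasing (F : R -> R) (a b B : R) :
  a < b -> (forall x y, a < x -> x <= y -> y < b -> F x <= F y) ->
  (forall x, a < x < b -> F x <= B) ->
  exists L, filterlim F (at_left b) (locally L).
Proof.
intros Hab Hm HB.
destruct (completeness (fun y => exists x, a < x < b /\ y = F x)) as [L [HL1 HL2]].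
- exists B. intros y [x [Hx ->]]. now apply HB.
- exists (F ((a + b) / 2)), ((a + b) / 2). split; [lra | reflexivity].
- exists L. apply filterlim_locally. intros e.
  assert (He := cond_pos e).
  assert (exists x, a < x < b /\ L - e < F x) as [x [Hx Hxe]].
  { apply Classical_Prop.NNPP. intros N.
    assert (L <= L - e); [|lra].
    apply HL2. intros y [x [Hx ->]]. apply Rnot_lt_le. intros N2. apply N. now exists x. }
  generalize (at_left_gt x b (proj2 Hx)). apply filter_imp. intros y Hy.
  assert (F x <= F y) by (apply Hm; lra).
  assert (F y <= L) by (apply HL1; exists y; split; [lra | reflexivity]).
  unfold ball; simpl; unfold AbsRing_ball, abs, minus, plus, opp; simpl.
  apply Rabs_def1; lra.
Qed.

Lemma is_derive_Rpower (y x : R) : 0 < x -> is_derive (fun x => Rpower x y) x (y * Rpower x (y - 1)).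
Proof. intros Hx. now apply is_derive_Reals, derivable_pt_lim_power. Qed.

Lemma filterlim_Rpower_0 (a : R) : 0 < a -> filterlim (fun u => Rpower u a) (at_right 0) (locally 0).
Proof.
intros Ha. unfold Rpower.
apply (filterlim_comp _ _ _ (fun u => a * ln u) exp _ (Rbar_locally m_infty)).
- apply (filterlim_comp _ _ _ ln (fun y => a * y) _ (Rbar_locally m_infty)); [apply is_lim_ln_0|].
  intros P [M HM]. exists (M / a). intros x Hx. apply HM.
  apply (Rmult_lt_compat_l a) in Hx; [|exact Ha].
  replace (a * (M / a)) with M in Hx by (field; lra). exact Hx.
- apply is_lim_exp_m.
Qed.

Lemma filterlim_0_of_Rpower_bound (F : R -> R) (C a : R) :
  0 < a -> (forall u, 0 < u < 1 -> Rabs (F u) <= C * Rpower u a) ->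
  filterlim F (at_right 0) (locally 0).
Proof.
intros Ha HF.
assert (H : filterlim (fun u => C * Rpower u a) (at_right 0) (Rbar_locally 0)).
{ replace (Finite 0) with (Finite (C * 0)) by (f_equal; ring).
  apply (filterlim_comp _ _ _ (fun u => Rpower u a) (fun y => C * y) _ (locally 0)).
  now apply filterlim_Rpower_0.
  apply (continuous_mult (K := R_AbsRing) (fun _ => C) (fun y => y)).
  apply continuous_const. apply continuous_id. }
apply (filterlim_le_le (fun u => - (C * Rpower u a)) F (fun u => C * Rpower u a) 0).
- generalize at_right_0_open_unit. apply filter_imp. intros u Hu.
  specialize (HF u Hu). apply Rabs_le_between in HF. lra.
- replace (Finite 0) with (Rbar_opp 0) by (simpl; f_equal; ring).
  apply (filterlim_comp _ _ _ _ _ _ (Rbar_locally 0)); [apply H|]. apply filterlim_Rbar_opp.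
- apply H.
Qed.

(** The integral from 1/2 is monotone, and its increments are dominated by those of [H], the
    primitive of the bound that vanishes at 0. It is therefore bounded near 0, and subtracting its
    limit there gives the primitive vanishing at 0. The 4/3 and the 3/4 come from integrating
    u^(-1/4). *)
Lemma dominated_primitive (f : R -> R) (C : R) :
  (forall u, 0 < u < 1 -> continuous f u) ->
  (forall u, 0 < u < 1 -> 0 <= f u <= C * Rpower u (- (1 / 4))) ->
  exists F : R -> R,
  (forall u, 0 < u < 1 -> is_derive F u (f u)) /\
  (forall u, 0 < u < 1 -> 0 <= F u <= C * (4 / 3) * Rpower u (3 / 4)).
Proof.
intros Hc Hf.
set (F0 := fun x => RInt f (1 / 2) x).
set (H := fun x => C * (4 / 3) * Rpower x (3 / 4)).
assert (HC : 0 <= C).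
{ specialize (Hf (1 / 2) ltac:(lra)). assert (P : 0 < Rpower (1 / 2) (- (1 / 4))) by apply exp_pos.
  apply Rmult_le_reg_r with (1 := P). lra. }
assert (Hpos : forall x, 0 <= H x).
{ intros x. unfold H. assert (P : 0 < Rpower x (3 / 4)) by apply exp_pos.
  apply Rmult_le_pos; lra. }
assert (HF0 : forall x, 0 < x < 1 -> is_derive F0 x (f x)).
{ intros x Hx. apply (is_derive_RInt (V := R_NormedModule) f F0 (1 / 2)); [|apply Hc, Hx].
  generalize (locally_open_interval 0 1 x Hx). apply filter_imp. intros y Hy.
  apply (RInt_correct (V := R_CompleteNormedModule)).
  apply (ex_RInt_continuous (V := R_CompleteNormedModule)). intros z Hz. apply Hc.
  generalize (Rmin_glb_lt (1 / 2) y 0) (Rmax_lub_lt (1 / 2) y 1). lra. }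
assert (HH : forall x, 0 < x < 1 -> is_derive H x (C * Rpower x (- (1 / 4)))).
{ intros x Hx. unfold H. evar_last.
  apply is_derive_scal, is_derive_Rpower; lra.
  simpl. replace (3 / 4 - 1) with (- (1 / 4)) by field. field. }
assert (M1 : forall x y, 0 < x -> x <= y -> y < 1 -> F0 x <= F0 y).
{ intros x y Hx Hxy Hy. apply (le_of_derive_nonneg F0 f x y Hxy).
  - intros z Hz; apply HF0; lra.
  - intros z Hz; apply Hf; lra. }
assert (M2 : forall x y, 0 < x -> x <= y -> y < 1 -> F0 y - F0 x <= H y - H x).
{ intros x y Hx Hxy Hy.
  assert (H x - F0 x <= H y - F0 y); [|lra].
  apply (le_of_derive_nonneg (fun z => H z - F0 z) (fun z => C * Rpower z (- (1 / 4)) - f z) x y Hxy).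
  - intros z Hz. apply (is_derive_minus (V := R_NormedModule) H F0); [apply HH | apply HF0]; lra.
  - intros z Hz. generalize (Hf z ltac:(lra)). lra. }
(* The supremum [l] is minus the limit of [F0] at 0, since [F0] is nondecreasing. *)
destruct (completeness (fun y => exists x, 0 < x < 1 /\ y = - F0 x)) as [l [Hl1 Hl2]].
- exists (- (F0 (1 / 2) - H (1 / 2))). intros y [x [Hx ->]].
  assert (F0 (1 / 2) - H (1 / 2) <= F0 x); [|lra].
  destruct (Rle_lt_dec x (1 / 2)) as [L|L].
  + generalize (M2 x (1 / 2) ltac:(lra) L ltac:(lra)) (Hpos x). lra.
  + generalize (M1 (1 / 2) x ltac:(lra) ltac:(lra) ltac:(lra)) (Hpos (1 / 2)). lra.
- exists (- F0 (1 / 2)), (1 / 2). split; [lra | reflexivity].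
- exists (fun x => F0 x + l). split.
  + intros u Hu. evar_last.
    apply (is_derive_plus (V := R_NormedModule) F0 (fun _ => l)); [apply HF0, Hu | apply is_derive_const].
    apply plus_zero_r.
  + intros u Hu. split.
    * assert (- F0 u <= l) by (apply Hl1; exists u; split; [exact Hu | reflexivity]). lra.
    * fold (H u). assert (l <= H u - F0 u); [|lra].
      apply Hl2. intros y [x [Hx ->]].
      destruct (Rle_lt_dec x u) as [L|L].
      -- generalize (M2 x u ltac:(lra) L ltac:(lra)) (Hpos x). lra.
      -- generalize (M1 u x ltac:(lra) ltac:(lra) ltac:(lra)) (Hpos u). lra.
Qed.

(** The function [I0 f] coincides on (0,1) with the primitive vanishing at 0. It is nondecreasing
    and bounded there because u^(3/4) < 1, which yields the limit at 1. *)
Lemma I0_dominated (f : R -> R) (C : R) :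
  (forall u, 0 < u < 1 -> continuous f u) ->
  (forall u, 0 < u < 1 -> 0 <= f u <= C * Rpower u (- (1 / 4))) ->
  (forall u, 0 < u < 1 -> is_derive (I0 f) u (f u)) /\
  (forall u, 0 < u < 1 -> 0 <= I0 f u <= C * (4 / 3) * Rpower u (3 / 4)) /\
  (exists L, filterlim (I0 f) (at_left 1) (locally L)).
Proof.
intros Hc Hf.
destruct (dominated_primitive f C Hc Hf) as [F [HF HB]].
assert (L0 : filterlim F (at_right 0) (locally 0)).
{ apply filterlim_0_of_Rpower_bound with (C * (4 / 3)) (3 / 4); [lra|].
  intros u Hu. rewrite Rabs_pos_eq; apply HB, Hu. }
assert (E : forall u, 0 < u < 1 -> I0 f u = F u).
{ intros u Hu. now apply I0_primitive. }
assert (HD : forall u, 0 < u < 1 -> is_derive (I0 f) u (f u)).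
{ intros u Hu. apply is_derive_ext_loc with F; [|apply HF, Hu].
  generalize (locally_open_interval 0 1 u Hu). apply filter_imp. intros y Hy. symmetry; now apply E. }
split; [exact HD|]. split.
- intros u Hu. rewrite (E u Hu). apply HB, Hu.
- apply (filterlim_at_left_nondecreasing (I0 f) 0 1 (C * (4 / 3))); [lra | |].
  + intros x y Hx Hxy Hy. apply (le_of_derive_nonneg _ f x y Hxy).
    * intros z Hz; apply HD; lra.
    * intros z Hz; apply Hf; lra.
  + intros x Hx. rewrite (E x Hx). apply Rle_trans with (1 := proj2 (HB x Hx)).
    assert (HC : 0 <= C).
    { specialize (Hf (1 / 2) ltac:(lra)). assert (P : 0 < Rpower (1 / 2) (- (1 / 4))) by apply exp_pos.
      apply Rmult_le_reg_r with (1 := P). lra. }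
    assert (Rpower x (3 / 4) < 1).
    { rewrite <- exp_0. apply exp_increasing.
      assert (ln x < 0) by (apply ln_neg; lra). lra. }
    nra.
Qed.
(** * The likelihood ratio and its logarithmic moments *)

(* The likelihood ratio of N(mu,1) against N(0,1) at the observation with p-value [u]. *)
Definition lik (mu u : R) : R := exp (mu * Phi_inv (1 - u) - mu ^ 2 / 2).

Lemma phi_dens_shift (mu x : R) : phi_dens (x - mu) = exp (mu * x - mu ^ 2 / 2) * phi_dens x.
Proof.
unfold phi_dens. unfold Rdiv at 1 4. rewrite <- Rmult_assoc, <- exp_plus.
do 2 f_equal. field.
Qed.

Lemma lik_pos (mu u : R) : 0 < lik mu u.
Proof. apply exp_pos. Qed.

Lemma continuous_upper_quantile (u : R) : 0 < u < 1 -> continuous upper_quantile u.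
Proof.
intros Hu. apply (ex_derive_continuous (K := R_AbsRing) (V := R_NormedModule)).
eexists; apply is_derive_upper_quantile, Hu.
Qed.

Lemma continuous_lik (mu u : R) : 0 < u < 1 -> continuous (lik mu) u.
Proof.
intros Hu. apply (continuous_comp upper_quantile (fun x => exp (mu * x - mu ^ 2 / 2))).
- now apply continuous_upper_quantile.
- apply (ex_derive_continuous (K := R_AbsRing) (V := R_NormedModule)). auto_derive; easy.
Qed.

Lemma lik_decreasing (mu u v : R) : 0 < mu -> 0 < u -> u <= v -> v < 1 -> lik mu v <= lik mu u.
Proof.
intros Hmu Hu [Huv|Huv] Hv.
- apply Rlt_le, exp_increasing.
  generalize (upper_quantile_decreasing u v Hu Huv Hv). unfold upper_quantile. nra.
- rewrite Huv; lra.
Qed.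

(** The distribution function of the p-value of an N(mu,1) observation, with density [lik mu]; [D]
    mixes it with the uniform one. *)
Definition alt_cdf (mu u : R) : R := 1 - Phi (Phi_inv (1 - u) - mu).

Lemma is_derive_alt_cdf (mu u : R) : 0 < u < 1 -> is_derive (alt_cdf mu) u (lik mu u).
Proof.
intros Hu. unfold alt_cdf.
assert (Hq := is_derive_upper_quantile u Hu).
evar_last.
apply (is_derive_minus (V := R_NormedModule) (fun _ => 1) (fun u => Phi (upper_quantile u - mu))).
apply is_derive_const.
apply (is_derive_comp Phi (fun u => upper_quantile u - mu)).
apply is_derive_Phi.
apply (is_derive_minus (V := R_NormedModule) upper_quantile (fun _ => mu)).
apply Hq. apply is_derive_const.
rewrite phi_dens_shift. unfold lik. fold (upper_quantile u).
generalize (phi_dens_pos (upper_quantile u)); intros P.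
unfold scal, minus, plus, opp, zero; simpl; unfold mult; simpl. field. lra.
Qed.

Lemma filterlim_Phi_shift (mu : R) (x l : Rbar) :
  is_lim Phi x l -> (x = p_infty \/ x = m_infty) ->
  filterlim (fun y => Phi (y - mu)) (Rbar_locally x) (Rbar_locally l).
Proof.
intros H Hx.
apply (filterlim_comp _ _ _ (fun y => y - mu) Phi _ (Rbar_locally x)).
- destruct Hx as [-> | ->]; intros P [M HM]; exists (M + mu); intros y Hy; apply HM; lra.
- destruct Hx as [-> | ->]; exact H.
Qed.

Lemma filterlim_one_minus (T : Type) (F : (T -> Prop) -> Prop) (FF : Filter F) (f : T -> R) (l : R) :
  filterlim f F (locally l) -> filterlim (fun x => 1 - f x) F (locally (1 - l)).
Proof.
intros H. apply (filterlim_comp _ _ _ f (fun y => 1 - y) _ (locally l)); [exact H|].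
apply (continuous_minus (V := R_NormedModule) (fun _ => 1) (fun y => y)).
apply continuous_const. apply continuous_id.
Qed.

Lemma filterlim_alt_cdf_0 (mu : R) : filterlim (alt_cdf mu) (at_right 0) (locally 0).
Proof.
replace (locally 0) with (locally (1 - 1)) by (f_equal; ring).
apply filterlim_one_minus; [typeclasses eauto|].
apply (filterlim_comp _ _ _ upper_quantile (fun y => Phi (y - mu)) _ (Rbar_locally p_infty)).
- apply filterlim_upper_quantile_0.
- apply (filterlim_Phi_shift mu p_infty 1); [apply is_lim_Phi_p_infty | now left].
Qed.

Lemma filterlim_alt_cdf_1 (mu : R) : filterlim (alt_cdf mu) (at_left 1) (locally 1).
Proof.
replace (locally 1) with (locally (1 - 0)) by (f_equal; ring).
apply filterlim_one_minus; [typeclasses eauto|].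
apply (filterlim_comp _ _ _ upper_quantile (fun y => Phi (y - mu)) _ (Rbar_locally m_infty)).
- apply filterlim_upper_quantile_1.
- apply (filterlim_Phi_shift mu m_infty 0); [apply is_lim_Phi_m_infty | now right].
Qed.

Lemma alt_cdf_gt (mu u : R) : 0 < mu -> 0 < u < 1 -> u < alt_cdf mu u < 1.
Proof.
intros Hmu Hu. unfold alt_cdf. fold (upper_quantile u). split.
- assert (H := Phi_upper_quantile u Hu).
  assert (Phi (upper_quantile u - mu) < Phi (upper_quantile u)) by (apply Phi_increasing; lra). lra.
- generalize (Phi_pos (upper_quantile u - mu)); lra.
Qed.

Lemma filterlim_lik_1 (mu : R) : 0 < mu -> filterlim (lik mu) (at_left 1) (locally 0).
Proof.
intros Hmu.
apply (filterlim_comp _ _ _ upper_quantile (fun x => exp (mu * x - mu ^ 2 / 2)) _ (Rbar_locally m_infty)).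
- apply filterlim_upper_quantile_1.
- apply (filterlim_comp _ _ _ (fun x => mu * x - mu ^ 2 / 2) exp _ (Rbar_locally m_infty)).
  + intros P [M HM]. exists ((M + mu ^ 2 / 2) / mu). intros x Hx. apply HM.
    apply (Rmult_lt_compat_l mu) in Hx; [|exact Hmu].
    replace (mu * ((M + mu ^ 2 / 2) / mu)) with (M + mu ^ 2 / 2) in Hx by (field; lra). lra.
  + apply is_lim_exp_m.
Qed.

(** Expanding (y - a)^2 >= 0 gives phi(y) <= exp(a^2/2 - a y), so adding K exp(-a y) to [Phi] makes
    a nonincreasing function, which dominates the limit 1 of [Phi]. Since [a] is free, the tail
    decays faster than any exponential. *)
Lemma upper_tail_le_exp (a x : R) : 0 < a -> 1 - Phi x <= exp (a ^ 2 / 2) / a * exp (- a * x).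
Proof.
intros Ha.
set (K := exp (a ^ 2 / 2) / a).
assert (HK : 0 < K) by (apply Rdiv_lt_0_compat; [apply exp_pos | exact Ha]).
set (f := fun x => Phi x + K * exp (- a * x)).
assert (Hd : forall y, is_derive f y (phi_dens y - a * K * exp (- a * y))).
{ intros y. unfold f. evar_last.
  apply (is_derive_plus (V := R_NormedModule) Phi (fun x => K * exp (- a * x))).
  apply is_derive_Phi. instantiate (1 := - a * K * exp (- a * y)). auto_derive; [easy | ring].
  unfold plus; simpl. ring. }
assert (Hn : forall y, phi_dens y <= a * K * exp (- a * y)).
{ intros y. replace (a * K) with (exp (a ^ 2 / 2)) by (unfold K; field; lra).
  rewrite <- exp_plus. unfold phi_dens.
  assert (1 <= sqrt (2 * PI)).
  { rewrite <- sqrt_1. apply sqrt_le_1; generalize PI2_1; lra. }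
  assert (E : exp (- y ^ 2 / 2) <= exp (a ^ 2 / 2 + - a * y)).
  { assert (Q := pow2_ge_0 (y - a)).
    destruct (Req_dec (- y ^ 2 / 2) (a ^ 2 / 2 + - a * y)) as [-> | N]; [lra|].
    apply Rlt_le, exp_increasing. nra. }
  apply Rle_trans with (2 := E).
  apply Rmult_le_reg_r with (sqrt (2 * PI)); [lra|].
  unfold Rdiv at 1. rewrite Rmult_assoc, Rinv_l by lra.
  generalize (exp_pos (- y ^ 2 / 2)). nra. }
assert (Hdec : forall y, x <= y -> f y <= f x).
{ intros y Hy.
  assert (- f x <= - f y); [|lra].
  apply (le_of_derive_nonneg (fun y => - f y) (fun y => - (phi_dens y - a * K * exp (- a * y))) x y Hy).
  - intros z _. apply (is_derive_opp (V := R_NormedModule)), Hd.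
  - intros z _. generalize (Hn z). lra. }
assert (1 <= f x); [|unfold f in *; lra].
apply (is_lim_le_loc Phi (fun _ => f x) p_infty 1 (f x)).
- exists x. intros y Hy. generalize (Hdec y ltac:(lra)). unfold f at 1.
  generalize (exp_pos (- a * y)). nra.
- apply is_lim_Phi_p_infty.
- apply is_lim_const.
Qed.

(** With [a = 8 * mu] the tail bound at the quantile x of u reads u <= K exp(-8 mu x), hence exp(mu
    x) <= (K/u)^(1/8). The exponent 1/8 leaves room for another 1/8 spent on the logarithms. *)
Lemma lik_le_Rpower (mu : R) : 0 < mu ->
  exists C, 0 < C /\ forall u, 0 < u < 1 -> lik mu u <= C * Rpower u (- (1 / 8)).
Proof.
intros Hmu.
set (K := exp ((8 * mu) ^ 2 / 2) / (8 * mu)).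
assert (HK : 0 < K) by (apply Rdiv_lt_0_compat; [apply exp_pos | lra]).
exists (exp (ln K / 8)). split; [apply exp_pos|]. intros u Hu.
assert (H := upper_tail_le_exp (8 * mu) (upper_quantile u) ltac:(lra)).
rewrite Phi_upper_quantile in H by exact Hu. fold K in H.
replace (1 - (1 - u)) with u in H by ring.
apply ln_le in H; [|apply Hu].
rewrite ln_mult, ln_exp in H; [|exact HK | apply exp_pos].
unfold lik, Rpower. fold (upper_quantile u). rewrite <- exp_plus.
assert (I : mu * upper_quantile u - mu ^ 2 / 2 <= ln K / 8 + - (1 / 8) * ln u) by nra.
destruct I as [I|I]; [apply Rlt_le, exp_increasing, I | rewrite I; lra].
Qed.

Lemma opp_ln_le_Rpower (u : R) : 0 < u < 1 -> 0 < - ln u <= 16 * Rpower u (- (1 / 16)).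
Proof.
intros Hu. assert (ln u < 0) by (apply ln_neg; lra).
split; [lra|]. unfold Rpower.
generalize (exp_ineq1_le (- (1 / 16) * ln u)). lra.
Qed.

Lemma sqr_ln_le_Rpower (u : R) : 0 < u < 1 -> 1 + ln u ^ 2 <= 257 * Rpower u (- (1 / 8)).
Proof.
intros Hu. assert (H := opp_ln_le_Rpower u Hu).
assert (E : Rpower u (- (1 / 8)) = Rpower u (- (1 / 16)) * Rpower u (- (1 / 16))).
{ rewrite <- Rpower_plus. f_equal. field. }
assert (1 <= Rpower u (- (1 / 16))).
{ unfold Rpower. rewrite <- exp_0 at 1. apply Rlt_le, exp_increasing. lra. }
rewrite E. nra.
Qed.

(** The weight [1 + ln u ^ 2] dominates 1, [- ln u] and [ln u ^ 2] at once, so this bound serves the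
    distribution function and both logarithmic moments. *)
Lemma lik_moment_dominated (mu : R) : 0 < mu ->
  exists C, 0 < C /\ forall u, 0 < u < 1 -> (1 + ln u ^ 2) * lik mu u <= C * Rpower u (- (1 / 4)).
Proof.
intros Hmu. destruct (lik_le_Rpower mu Hmu) as [C [HC H]].
exists (257 * C). split; [lra|]. intros u Hu.
specialize (H u Hu). assert (H2 := sqr_ln_le_Rpower u Hu).
replace (Rpower u (- (1 / 4))) with (Rpower u (- (1 / 8)) * Rpower u (- (1 / 8))).
2:{ rewrite <- Rpower_plus. f_equal. field. }
replace (257 * C * (Rpower u (- (1 / 8)) * Rpower u (- (1 / 8)))) with
 ((257 * Rpower u (- (1 / 8))) * (C * Rpower u (- (1 / 8)))) by ring.
apply Rmult_le_compat; try assumption.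
- generalize (pow2_ge_0 (ln u)); lra.
- apply Rlt_le, lik_pos.
Qed.

Lemma continuous_ln (u : R) : 0 < u -> continuous ln u.
Proof. intros Hu. apply (ex_derive_continuous (K := R_AbsRing) (V := R_NormedModule)). auto_derive; exact Hu. Qed.

(** Truncated moments of -ln P under N(mu,1). The sign in the first one makes the integrand
    nonnegative, as [I0_dominated] requires. *)
Definition lik_log (mu : R) : R -> R := I0 (fun u => - ln u * lik mu u).
Definition lik_log2 (mu : R) : R -> R := I0 (fun u => ln u ^ 2 * lik mu u).

Lemma lik_log_spec (mu : R) : 0 < mu -> exists C,
  (forall u, 0 < u < 1 -> is_derive (lik_log mu) u (- ln u * lik mu u)) /\
  (forall u, 0 < u < 1 -> 0 <= lik_log mu u <= C * Rpower u (3 / 4)) /\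
  (exists L, filterlim (lik_log mu) (at_left 1) (locally L)).
Proof.
intros Hmu. destruct (lik_moment_dominated mu Hmu) as [C [HC H]].
exists (C * (4 / 3)). apply I0_dominated.
- intros u Hu. apply (continuous_mult (K := R_AbsRing) (fun u => - ln u) (lik mu)).
  + apply (continuous_opp (V := R_NormedModule) ln), continuous_ln, Hu.
  + now apply continuous_lik.
- intros u Hu. specialize (H u Hu). assert (P := lik_pos mu u).
  assert (N := opp_ln_le_Rpower u Hu). split.
  + apply Rmult_le_pos; lra.
  + apply Rle_trans with (2 := H). apply Rmult_le_compat_r; nra.
Qed.

Lemma lik_log2_spec (mu : R) : 0 < mu -> exists C,
  (forall u, 0 < u < 1 -> is_derive (lik_log2 mu) u (ln u ^ 2 * lik mu u)) /\
  (forall u, 0 < u < 1 -> 0 <= lik_log2 mu u <= C * Rpower u (3 / 4)) /\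
  (exists L, filterlim (lik_log2 mu) (at_left 1) (locally L)).
Proof.
intros Hmu. destruct (lik_moment_dominated mu Hmu) as [C [HC H]].
exists (C * (4 / 3)). apply I0_dominated.
- intros u Hu. apply (continuous_mult (K := R_AbsRing) (fun u => ln u ^ 2) (lik mu)).
  + apply (ex_derive_continuous (K := R_AbsRing) (V := R_NormedModule)). auto_derive; apply Hu.
  + now apply continuous_lik.
- intros u Hu. specialize (H u Hu). assert (P := lik_pos mu u).
  assert (N := pow2_ge_0 (ln u)). split.
  + apply Rmult_le_pos; lra.
  + apply Rle_trans with (2 := H). apply Rmult_le_compat_r; lra.
Qed.

Lemma alt_cdf_le_Rpower (mu : R) : 0 < mu -> exists C,
  forall u, 0 < u < 1 -> alt_cdf mu u <= C * Rpower u (3 / 4).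
Proof.
intros Hmu. destruct (lik_moment_dominated mu Hmu) as [C [HC H]].
exists (C * (4 / 3)). intros u Hu.
assert (E : I0 (lik mu) u = alt_cdf mu u).
{ apply I0_primitive; try assumption.
  - apply is_derive_alt_cdf.
  - apply continuous_lik.
  - apply filterlim_alt_cdf_0. }
rewrite <- E. apply (I0_dominated (lik mu) C); try assumption.
- apply continuous_lik.
- intros v Hv. specialize (H v Hv). assert (P := lik_pos mu v).
  generalize (pow2_ge_0 (ln v)). nra.
Qed.

(** The density [lik mu] is decreasing, so the tangent at [t] lies above the curve; the inequality
    is passed to the limit at 1. The next lemma does the same at 0. *)
Lemma alt_cdf_concave_1 (mu t : R) : 0 < mu -> 0 < t < 1 -> 1 - alt_cdf mu t <= lik mu t * (1 - t).
Proof.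
intros Hmu Ht.
assert (forall y, t < y < 1 -> alt_cdf mu y <= alt_cdf mu t + lik mu t * (y - t)).
{ intros y Hy.
  assert (lik mu t * t - alt_cdf mu t <= lik mu t * y - alt_cdf mu y); [|lra].
  apply (le_of_derive_nonneg (fun z => lik mu t * z - alt_cdf mu z) (fun z => lik mu t - lik mu z) t y); [lra | |].
  - intros z Hz. evar_last.
    apply (is_derive_minus (V := R_NormedModule) (fun z => lik mu t * z) (alt_cdf mu)).
    apply is_derive_scal, is_derive_id. apply is_derive_alt_cdf; lra.
    unfold minus, plus, opp, one; simpl. ring.
  - intros z Hz. generalize (lik_decreasing mu t z Hmu ltac:(lra) ltac:(lra) ltac:(lra)). lra. }
assert (1 <= alt_cdf mu t + lik mu t * (1 - t)); [|lra].
apply (filterlim_le (F := at_left 1) (alt_cdf mu) (fun y => alt_cdf mu t + lik mu t * (1 - t)) 1 (alt_cdf mu t + lik mu t * (1 - t))).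
- generalize (at_left_gt t 1 (proj2 Ht)). apply filter_imp. intros y Hy.
  specialize (H y Hy). generalize (lik_pos mu t). nra.
- apply filterlim_alt_cdf_1.
- apply filterlim_const.
Qed.

Lemma alt_cdf_concave_0 (mu t : R) : 0 < mu -> 0 < t < 1 -> t * lik mu t <= alt_cdf mu t.
Proof.
intros Hmu Ht.
assert (forall y, 0 < y < t -> alt_cdf mu y <= alt_cdf mu t - lik mu t * (t - y)).
{ intros y Hy.
  assert (alt_cdf mu y - lik mu t * y <= alt_cdf mu t - lik mu t * t); [|lra].
  apply (le_of_derive_nonneg (fun z => alt_cdf mu z - lik mu t * z) (fun z => lik mu z - lik mu t) y t); [lra | |].
  - intros z Hz. evar_last.
    apply (is_derive_minus (V := R_NormedModule) (alt_cdf mu) (fun z => lik mu t * z)).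
    apply is_derive_alt_cdf; lra. apply is_derive_scal, is_derive_id.
    unfold minus, plus, opp, one; simpl. ring.
  - intros z Hz. generalize (lik_decreasing mu z t Hmu ltac:(lra) ltac:(lra) ltac:(lra)). lra. }
apply (filterlim_le (F := at_right 0) (fun y => (t - y) * lik mu t) (fun y => alt_cdf mu t) (t * lik mu t) (alt_cdf mu t)).
- generalize (at_right_lt 0 t (proj1 Ht)). apply filter_imp. intros y Hy.
  specialize (H y Hy). generalize (alt_cdf_gt mu y Hmu ltac:(lra)). nra.
- apply (filterlim_filter_le_1 (F := locally 0) (G := at_right 0) (H := locally (t * lik mu t))). { apply filter_le_within. }
  replace (t * lik mu t) with ((t - 0) * lik mu t) by ring.
  apply (ex_derive_continuous (K := R_AbsRing) (V := R_NormedModule) (fun y => (t - y) * lik mu t) 0).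
  auto_derive; easy.
- apply filterlim_const.
Qed.

(** * The lower bound on the mean of -ln under the alternative *)

(** Write exp(x^2/2) as the (n+1)-st power of exp(x^2/(2(n+1))) and bound the latter below by its
    exponent. *)
Lemma exp_half_sqr_le (n : nat) (x : R) : x <> 0 ->
  exp (- x ^ 2 / 2) <= (2 * INR (S n)) ^ S n / (x ^ 2) ^ S n.
Proof.
intros Hx.
assert (Hn : 0 < INR (S n)) by (apply lt_0_INR; lia).
assert (Hx2 : 0 < x ^ 2) by (apply pow2_gt_0, Hx).
assert (E : exp (- x ^ 2 / 2) = / (exp (x ^ 2 / 2 / INR (S n))) ^ S n).
{ rewrite <- (Rpower_pow (S n) (exp _)) by apply exp_pos. unfold Rpower. rewrite ln_exp, <- exp_Ropp. f_equal. field. lra. }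
rewrite E.
replace ((2 * INR (S n)) ^ S n / (x ^ 2) ^ S n) with (/ (x ^ 2 / 2 / INR (S n)) ^ S n).
2:{ replace (x ^ 2 / 2 / INR (S n)) with (x ^ 2 * / (2 * INR (S n))) by (field; lra).
    rewrite Rpow_mult_distr, pow_inv.
    assert (0 < (x ^ 2) ^ S n) by (apply pow_lt, Hx2).
    assert (0 < (2 * INR (S n)) ^ S n) by (apply pow_lt; lra).
    rewrite Rinv_mult, Rinv_inv. apply Rmult_comm. }
assert (P : 0 < x ^ 2 / 2 / INR (S n)) by (repeat apply Rdiv_lt_0_compat; lra).
apply Rinv_le_contravar; [apply pow_lt, P|].
apply pow_incr. generalize (exp_ineq1_le (x ^ 2 / 2 / INR (S n))). lra.
Qed.

Lemma pow_phi_dens_small (k : nat) (e : R) : 0 < e ->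
  exists B, 0 < B /\ forall x, B < Rabs x -> Rabs (x ^ k * phi_dens x) < e.
Proof.
intros He.
set (K := (2 * INR (S k)) ^ S k / sqrt (2 * PI)).
assert (HK : 0 < K).
{ apply Rdiv_lt_0_compat; [apply pow_lt | apply sqrt_2PI_pos].
  assert (0 < INR (S k)) by (apply lt_0_INR; lia). lra. }
exists (Rmax 1 (K / e)). split.
{ apply Rlt_le_trans with 1; [lra | apply Rmax_l]. }
intros x Hx.
assert (H1 : 1 < Rabs x) by (generalize (Rmax_l 1 (K / e)); lra).
assert (H2 : K / e < Rabs x) by (generalize (Rmax_r 1 (K / e)); lra).
assert (Hx0 : x <> 0) by (intros ->; rewrite Rabs_R0 in H1; lra).
assert (H := exp_half_sqr_le k x Hx0).
rewrite Rabs_mult, (Rabs_pos_eq (phi_dens x)) by apply Rlt_le, phi_dens_pos.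
rewrite <- RPow_abs.
assert (Hp : phi_dens x <= K / (x ^ 2) ^ S k).
{ unfold phi_dens, K.
  replace ((2 * INR (S k)) ^ S k / sqrt (2 * PI) / (x ^ 2) ^ S k)
    with ((2 * INR (S k)) ^ S k / (x ^ 2) ^ S k / sqrt (2 * PI)) by (unfold Rdiv; ring).
  apply Rmult_le_compat_r; [|exact H].
  apply Rlt_le, Rinv_0_lt_compat, sqrt_2PI_pos. }
assert (E : x ^ 2 = Rabs x ^ 2) by (symmetry; apply pow2_abs).
rewrite E in Hp.
set (a := Rabs x) in *.
assert (Hak : 1 <= a ^ k) by (apply pow_R1_Rle; lra).
assert (Ha : 0 < a) by lra.
apply Rle_lt_trans with (K / a).
- apply Rle_trans with (a ^ k * (K / (a ^ 2) ^ S k)).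
  + apply Rmult_le_compat_l; [apply pow_le; lra | exact Hp].
  + replace (a ^ k * (K / (a ^ 2) ^ S k)) with (K / a * / (a ^ S k)).
    2:{ rewrite <- pow_mult. replace (2 * S k)%nat with (S k + S k)%nat by lia.
        rewrite pow_add. simpl. field. split; [apply pow_nonzero|]; lra. }
    assert (0 < K / a) by (apply Rdiv_lt_0_compat; lra).
    assert (/ a ^ S k <= 1).
    { rewrite <- Rinv_1. apply Rinv_le_contravar; [lra|]. apply pow_R1_Rle; lra. }
    nra.
- apply Rmult_lt_reg_r with a; [lra|]. unfold Rdiv. rewrite Rmult_assoc, Rinv_l by lra.
  apply (Rmult_lt_compat_r e) in H2; [|exact He].
  unfold Rdiv in H2. rewrite Rmult_assoc, Rinv_l in H2 by lra. lra.
Qed.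

Lemma filterlim_pow_phi_dens (k : nat) (x : Rbar) : x = p_infty \/ x = m_infty ->
  filterlim (fun z => z ^ k * phi_dens z) (Rbar_locally x) (locally 0).
Proof.
intros Hx. apply filterlim_locally. intros e.
destruct (pow_phi_dens_small k e (cond_pos e)) as [B [HB H]].
assert (Hl : Rbar_locally x (fun z => B < Rabs z)).
{ destruct Hx as [-> | ->].
  - exists B. intros z Hz. rewrite Rabs_pos_eq; lra.
  - exists (- B). intros z Hz. rewrite Rabs_left; lra. }
revert Hl. apply filter_imp. intros z Hz.
unfold ball; simpl; unfold AbsRing_ball, abs, minus, plus, opp; simpl.
rewrite Ropp_0, Rplus_0_r. now apply H.
Qed.

(** Primitive of a polynomial of degree 6 times [phi_dens], found by repeated integration by parts.
    The factor of [Phi] is the Gaussian mean of the polynomial, 1, 3 and 15 being the even moments;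
    degree 6 is that of [log_poly]. *)
Definition gauss_prim (a0 a1 a2 a3 a4 a5 a6 z : R) : R :=
  (a0 + a2 + 3 * a4 + 15 * a6) * Phi z
  - ((a1 + 2 * a3 + 8 * a5) * (z ^ 0 * phi_dens z) + (a2 + 3 * a4 + 15 * a6) * (z ^ 1 * phi_dens z)
     + (a3 + 4 * a5) * (z ^ 2 * phi_dens z) + (a4 + 5 * a6) * (z ^ 3 * phi_dens z)
     + a5 * (z ^ 4 * phi_dens z) + a6 * (z ^ 5 * phi_dens z)).

Lemma is_derive_gauss_prim (a0 a1 a2 a3 a4 a5 a6 z : R) :
  is_derive (gauss_prim a0 a1 a2 a3 a4 a5 a6) z
    ((a0 + a1 * z + a2 * z ^ 2 + a3 * z ^ 3 + a4 * z ^ 4 + a5 * z ^ 5 + a6 * z ^ 6) * phi_dens z).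
Proof.
assert (HP := is_derive_Phi z). assert (Hp := is_derive_phi_dens z).
unfold gauss_prim. auto_derive.
- repeat split; solve [eexists; eassumption].
- replace (Derive (fun x : R => Phi x) z) with (phi_dens z) by (symmetry; apply is_derive_unique, HP).
  replace (Derive (fun x : R => phi_dens x) z) with (- z * phi_dens z) by (symmetry; apply is_derive_unique, Hp).
  ring.
Qed.

Lemma filterlim_gauss_prim (a0 a1 a2 a3 a4 a5 a6 : R) (x : Rbar) (l : R) :
  x = p_infty \/ x = m_infty -> filterlim Phi (Rbar_locally x) (locally l) ->
  filterlim (gauss_prim a0 a1 a2 a3 a4 a5 a6) (Rbar_locally x)
    (locally ((a0 + a2 + 3 * a4 + 15 * a6) * l)).
Proof.
intros Hx HP.
set (c := a0 + a2 + 3 * a4 + 15 * a6).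
assert (S : forall (f : R -> R) k m, filterlim f (Rbar_locally x) (locally m) ->
   filterlim (fun z => k * f z) (Rbar_locally x) (locally (k * m))).
{ intros f k m Hf. apply (filterlim_comp _ _ _ f (fun y => k * y) _ (locally m)); [exact Hf|].
  apply (continuous_mult (K := R_AbsRing) (fun _ => k) (fun y => y)); [apply continuous_const | apply continuous_id]. }
assert (Pl : forall (f g : R -> R) m n, filterlim f (Rbar_locally x) (locally m) ->
   filterlim g (Rbar_locally x) (locally n) ->
   filterlim (fun z => f z + g z) (Rbar_locally x) (locally (m + n))).
{ intros f g m n Hf Hg. eapply (filterlim_comp_2 f g Rplus); [exact Hf | exact Hg |].
  apply (filterlim_plus (V := R_NormedModule)). }
assert (Z : forall k c, filterlim (fun z => c * (z ^ k * phi_dens z)) (Rbar_locally x) (locally 0)).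
{ intros k d. replace (locally 0) with (locally (d * 0)) by (f_equal; ring).
  apply S. now apply filterlim_pow_phi_dens. }
unfold gauss_prim. fold c.
apply (filterlim_ext (fun z => c * Phi z + (-1) * ((a1 + 2 * a3 + 8 * a5) * (z ^ 0 * phi_dens z) + (a2 + 3 * a4 + 15 * a6) * (z ^ 1 * phi_dens z)
     + (a3 + 4 * a5) * (z ^ 2 * phi_dens z) + (a4 + 5 * a6) * (z ^ 3 * phi_dens z)
     + a5 * (z ^ 4 * phi_dens z) + a6 * (z ^ 5 * phi_dens z)))).
{ intros z. ring. }
replace (c * l) with (c * l + (-1) * (0 + 0 + 0 + 0 + 0 + 0)) by ring.
apply Pl; [now apply S|]. apply S. repeat apply Pl; apply Z.
Qed.

(** The integrand is nonnegative, so the primitive increases from 0 to the Gaussian mean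
    [a0 + a2]. *)
Lemma gauss_prim_quadratic_bounds (a0 a1 a2 x : R) :
  (forall t, 0 <= a0 + a1 * t + a2 * t ^ 2) ->
  0 <= gauss_prim a0 a1 a2 0 0 0 0 x <= a0 + a2.
Proof.
intros H.
set (G := gauss_prim a0 a1 a2 0 0 0 0).
assert (Hm : forall s t, s <= t -> G s <= G t).
{ intros s t Hst. eapply (le_of_derive_nonneg G _ s t Hst).
  - intros z _. apply is_derive_gauss_prim.
  - intros z _. apply Rmult_le_pos; [|apply Rlt_le, phi_dens_pos].
    generalize (H z). lra. }
split.
- apply (filterlim_le (F := Rbar_locally m_infty) G (fun _ => G x) 0 (G x)).
  + exists x. intros y Hy. apply Hm; lra.
  + replace (Finite 0) with (Finite ((a0 + a2 + 3 * 0 + 15 * 0) * 0)) by (f_equal; ring).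
    apply filterlim_gauss_prim; [now right | apply is_lim_Phi_m_infty].
  + apply filterlim_const.
- apply (filterlim_le (F := Rbar_locally p_infty) (fun _ => G x) G (G x) (a0 + a2)).
  + exists x. intros y Hy. apply Hm; lra.
  + apply filterlim_const.
  + replace (Finite (a0 + a2)) with (Finite ((a0 + a2 + 3 * 0 + 15 * 0) * 1)) by (f_equal; ring).
    apply filterlim_gauss_prim; [now left | apply is_lim_Phi_p_infty].
Qed.

(* [exp quad * mix_poly] approximates [z |-> 1 / (1 - Phi (z + 17/20))]: its coefficients maximise
   numerically the lower bound of [lik_log_lim_gt_2], under the constraint that 119/288 = (1 - 1/v)/2
   with [v] and [1 + v] squares of rationals, [v = 144/25].  A pure Gaussian (without [mix_poly])
   only yields 1.99999 instead of 2. *)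
Definition mix_poly (z : R) : R := 1 + 2 / 5 * z + 26 / 625 * z ^ 2.

Lemma mix_poly_pos (z : R) : 0 < mix_poly z.
Proof. unfold mix_poly. generalize (pow2_ge_0 (z + 125 / 26)). lra. Qed.

(* Taylor polynomial at 0 of the logarithm of [1 + t + 13/50 t^2], except that the last coefficient
   is lowered so that the difference has a derivative of the sign of [t]. *)
Definition log_poly (t : R) : R :=
  t - 6 / 25 * t ^ 2 + 11 / 150 * t ^ 3 - 119 / 5000 * t ^ 4 + 19 / 2500 * t ^ 5 - 1 / 400 * t ^ 6.

Lemma log_poly_le_ln (t : R) : log_poly t <= ln (1 + t + 13 / 50 * t ^ 2).
Proof.
assert (Hp : forall t, 0 < 1 + t + 13 / 50 * t ^ 2).
{ intros s. generalize (pow2_ge_0 (s + 25 / 13)). lra. }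
set (f := fun t => ln (1 + t + 13 / 50 * t ^ 2) - log_poly t).
set (q := fun t => (219 / 125000 + 16 / 3125 * t + 39 / 10000 * t ^ 2) / (1 + t + 13 / 50 * t ^ 2)).
assert (Hq : forall t, 0 <= q t).
{ intros s. unfold q. apply Rlt_le, Rdiv_lt_0_compat; [|apply Hp].
  generalize (pow2_ge_0 (s + 128 / 195)). lra. }
assert (Hd : forall t, is_derive f t (t ^ 5 * q t)).
{ intros s. unfold f, q, log_poly. specialize (Hp s). auto_derive; simpl in *; [lra | field; lra]. }
assert (E : f 0 = 0).
{ unfold f, log_poly. replace (1 + 0 + 13 / 50 * 0 ^ 2) with 1 by ring. rewrite ln_1. ring. }
assert (0 <= f t); [|unfold f in *; lra].
destruct (Rle_lt_dec 0 t) as [Ht|Ht].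
- rewrite <- E. apply (le_of_derive_nonneg f (fun t => t ^ 5 * q t)); [exact Ht | intros; apply Hd |].
  intros x Hx. apply Rmult_le_pos; [apply pow_le; lra | apply Hq].
- assert (- f t <= - f 0); [|lra].
  apply (le_of_derive_nonneg (fun t => - f t) (fun t => - (t ^ 5 * q t))); [lra | |].
  + intros. apply (is_derive_opp (V := R_NormedModule)), Hd.
  + intros x Hx. specialize (Hq x).
    assert (0 <= (- x) ^ 5) by (apply pow_le; lra).
    replace (- (x ^ 5 * q x)) with ((- x) ^ 5 * q x) by ring. nra.
Qed.

(** * The tangent minorant of -ln and its Gaussian weight *)

(** The summand 289/845 cancels [2601 / 800 - (697 / 260) ^ 2 / 2], so that [conv_bound (17 / 20)]
    contains the single exponential exp(2571/2000). The summand 2571/2000 brings that bound close to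
    1, the best normalisation: raising [quad] by k gains k and multiplies the subtracted integral by
    exp(k). *)
Definition quad0 : R := 2571 / 2000 + 289 / 845.
Definition quad (z : R) : R := quad0 + 17 / 16 * z + 119 / 288 * z ^ 2.

(** This is 1 + ln x <= x at x = r exp(quad z) mix_poly z. The logarithm of [mix_poly] is replaced
    by [log_poly] to make the Gaussian mean of the left part explicit. *)
Lemma opp_ln_ge (z r : R) : 0 < r ->
  1 + quad z + log_poly (2 / 5 * z) - r * (exp (quad z) * mix_poly z) <= - ln r.
Proof.
intros Hr.
assert (HM := mix_poly_pos z). assert (He := exp_pos (quad z)).
assert (HL := log_poly_le_ln (2 / 5 * z)).
replace (1 + 2 / 5 * z + 13 / 50 * (2 / 5 * z) ^ 2) with (mix_poly z) in HL by (unfold mix_poly; field).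
assert (Hx : 0 < r * (exp (quad z) * mix_poly z)) by (repeat apply Rmult_lt_0_compat; assumption).
assert (H := exp_ineq1_le (ln (r * (exp (quad z) * mix_poly z)))).
rewrite exp_ln in H by exact Hx.
rewrite ln_mult, ln_mult, ln_exp in H; try assumption; [lra|].
now apply Rmult_lt_0_compat.
Qed.

(** Apart from [mix_poly] and the constant 12/5 exp(quad0 + 2601/800), this is the density of the
    normal law with mean 153/25 and variance v = 144/25. *)
Definition gauss_weight (z : R) : R := phi_dens z * (exp (quad z) * mix_poly z).

Lemma gauss_weight_pos (z : R) : 0 < gauss_weight z.
Proof.
apply Rmult_lt_0_compat; [apply phi_dens_pos|].
apply Rmult_lt_0_compat; [apply exp_pos | apply mix_poly_pos].
Qed.

Lemma continuous_gauss_weight (z : R) : continuous gauss_weight z.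
Proof.
apply (continuous_mult (K := R_AbsRing) phi_dens (fun z => exp (quad z) * mix_poly z)).
apply continuous_phi_dens.
apply (ex_derive_continuous (K := R_AbsRing) (V := R_NormedModule)).
unfold quad, mix_poly. auto_derive; easy.
Qed.

(* In the product of the two Gaussian factors of [gauss_weight z * phi_dens (z + s)] the exponent is
   diagonalised by the coordinates [conv_x s z] and [conv_y s]. *)
Definition conv_y (s : R) : R := 5 / 13 * (s + 153 / 25).
Definition conv_x (s z : R) : R := 13 / 12 * (z - (153 / 25 - 144 / 65 * conv_y s)).

(** Completing the square in z. With v = 144/25, the constants of the coordinates are 13/5 =
    sqrt(1+v), 144/65 = v/sqrt(1+v) and 12/13 = sqrt(v/(1+v)), all rational by the choice of v. *)
Lemma gauss_weight_conv (s z : R) :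
  gauss_weight z * phi_dens (z + s) =
  exp (quad0 + 2601 / 800) * phi_dens (conv_y s) * (mix_poly z * phi_dens (conv_x s z)).
Proof.
assert (P := sqrt_2PI_pos). unfold gauss_weight, phi_dens, Rdiv.
set (k := / sqrt (2 * PI)).
transitivity (mix_poly z * k * k * (exp (- z ^ 2 * / 2) * exp (quad z) * exp (- (z + s) ^ 2 * / 2))); [ring|].
transitivity (mix_poly z * k * k * (exp (quad0 + 2601 * / 800) * exp (- conv_y s ^ 2 * / 2) * exp (- conv_x s z ^ 2 * / 2))); [|ring].
rewrite <- !exp_plus. do 2 f_equal. unfold quad, conv_x, conv_y. field.
Qed.

(** Coefficients, in powers of y = [conv_y s], of the mean of [mix_poly] under the normal law with
    mean 153/25 - 144/65 y and standard deviation 12/13. *)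
Definition conv_coef0 : R := 1 + 2 / 5 * (153 / 25) + 26 / 625 * ((153 / 25) ^ 2 + 144 / 169).
Definition conv_coef1 : R := - (144 / 65) * (2 / 5 + 2 * (26 / 625) * (153 / 25)).
Definition conv_coef2 : R := 26 / 625 * (144 / 65) ^ 2.

(** In the coordinate [conv_x s], with Jacobian 12/13, the integral over [l,r] is an increment of a
    primitive that stays between 0 and the full mean. *)
Lemma RInt_mix_poly_le (s l r : R) : l <= r ->
  RInt (fun z => mix_poly z * phi_dens (conv_x s z)) l r <=
  12 / 13 * (conv_coef0 + conv_coef1 * conv_y s + conv_coef2 * conv_y s ^ 2).
Proof.
intros Hlr.
set (m := 153 / 25 - 144 / 65 * conv_y s).
set (a0 := 1 + 2 / 5 * m + 26 / 625 * m ^ 2).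
set (a1 := 12 / 13 * (2 / 5 + 2 * (26 / 625) * m)).
set (a2 := 26 / 625 * (144 / 169)).
assert (HM : forall x, mix_poly (m + 12 / 13 * x) = a0 + a1 * x + a2 * x ^ 2).
{ intros x. unfold mix_poly, a0, a1, a2. field. }
set (G := gauss_prim a0 a1 a2 0 0 0 0).
assert (HG : forall x, 0 <= G x <= a0 + a2).
{ intros x. apply gauss_prim_quadratic_bounds. intros t. rewrite <- HM. apply Rlt_le, mix_poly_pos. }
assert (E : RInt (fun z => mix_poly z * phi_dens (conv_x s z)) l r =
  12 / 13 * G (conv_x s r) - 12 / 13 * G (conv_x s l)).
{ apply is_RInt_unique.
  apply (is_RInt_derive (V := R_CompleteNormedModule) (fun z => 12 / 13 * G (conv_x s z))).
  - intros z _. evar_last.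
    apply is_derive_scal.
    apply (is_derive_comp G (conv_x s)).
    apply is_derive_gauss_prim.
    instantiate (1 := 13 / 12). unfold conv_x. auto_derive; [easy | field].
    replace (mix_poly z) with (a0 + a1 * conv_x s z + a2 * conv_x s z ^ 2).
    2:{ rewrite <- HM. f_equal. unfold conv_x; fold m; field. }
    unfold scal; simpl; unfold mult; simpl. field.
  - intros z _. apply (continuous_mult (K := R_AbsRing) mix_poly (fun z => phi_dens (conv_x s z))).
    + apply (ex_derive_continuous (K := R_AbsRing) (V := R_NormedModule)). unfold mix_poly. auto_derive; easy.
    + apply (continuous_comp (conv_x s) phi_dens); [|apply continuous_phi_dens].
      apply (ex_derive_continuous (K := R_AbsRing) (V := R_NormedModule)). unfold conv_x. auto_derive; easy. }
rewrite E.
replace (conv_coef0 + conv_coef1 * conv_y s + conv_coef2 * conv_y s ^ 2) with (a0 + a2)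
  by (unfold conv_coef0, conv_coef1, conv_coef2, a0, a2, m; field).
generalize (HG (conv_x s r)) (HG (conv_x s l)). lra.
Qed.

(* The continued fraction of Laplace for Mills' ratio, truncated after the numerator 6. *)
Definition mills (y : R) : R :=
  (y ^ 6 + 20 * y ^ 4 + 87 * y ^ 2 + 48) / (y ^ 7 + 21 * y ^ 5 + 105 * y ^ 3 + 105 * y).

(** Mills' ratio solves m' = y m - 1. The truncated fraction misses this equation by -7!/Q(y)^2,
    with Q its denominator, and this sign makes it an upper bound. *)
Lemma mills_derive (y : R) : 0 < y ->
  exists d, is_derive mills y d /\ d - y * mills y + 1 <= 0.
Proof.
intros Hy.
assert (HQ : 0 < y ^ 7 + 21 * y ^ 5 + 105 * y ^ 3 + 105 * y).
{ assert (0 < y ^ 7) by (apply pow_lt, Hy). assert (0 < y ^ 5) by (apply pow_lt, Hy).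
  assert (0 < y ^ 3) by (apply pow_lt, Hy). lra. }
exists (y * mills y - 1 - 5040 / (y ^ 7 + 21 * y ^ 5 + 105 * y ^ 3 + 105 * y) ^ 2).
split.
- unfold mills. auto_derive.
  + simpl in *. lra.
  + field. lra.
- assert (0 < 5040 / (y ^ 7 + 21 * y ^ 5 + 105 * y ^ 3 + 105 * y) ^ 2).
  { apply Rdiv_lt_0_compat; [lra | apply pow_lt, HQ]. }
  lra.
Qed.

(** The integral of (c0 + c1 t + c2 t^2) phi(t) from y to infinity is phi(y) (c1 + c2 y) + (c0 + c2)
    (1 - Phi y); here y = [conv_y s] and the tail is replaced by phi(y) [mills y]. The factor 12/5
    is 12/13 times 13/5, the latter from ds = 13/5 dy. *)
Definition conv_bound (s : R) : R :=
  12 / 5 * exp (quad0 + 2601 / 800) *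
  (phi_dens (conv_y s) * (conv_coef1 + conv_coef2 * conv_y s + (conv_coef0 + conv_coef2) * mills (conv_y s))).

Lemma conv_coef_pos : 0 < conv_coef0 + conv_coef2.
Proof. unfold conv_coef0, conv_coef2. lra. Qed.

Lemma conv_bound_derive (s : R) : 0 <= s ->
  exists d, is_derive conv_bound s d /\
  d <= - (exp (quad0 + 2601 / 800) * phi_dens (conv_y s) *
          (12 / 13 * (conv_coef0 + conv_coef1 * conv_y s + conv_coef2 * conv_y s ^ 2))).
Proof.
intros Hs.
assert (Hy : 0 < conv_y s) by (unfold conv_y; lra).
destruct (mills_derive (conv_y s) Hy) as [d [Hd Hle]].
set (y := conv_y s) in *.
set (B := fun y => phi_dens y * (conv_coef1 + conv_coef2 * y + (conv_coef0 + conv_coef2) * mills y)).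
assert (HB : is_derive B y (phi_dens y * (conv_coef2 + (conv_coef0 + conv_coef2) * d - y * (conv_coef1 + conv_coef2 * y + (conv_coef0 + conv_coef2) * mills y)))).
{ unfold B. assert (Hp := is_derive_phi_dens y). auto_derive.
  - repeat split; eexists; eassumption.
  - replace (Derive (fun x : R => phi_dens x) y) with (- y * phi_dens y) by (symmetry; apply is_derive_unique, Hp).
    replace (Derive (fun x : R => mills x) y) with d by (symmetry; apply is_derive_unique, Hd).
    ring. }
eexists. split.
- unfold conv_bound. apply is_derive_scal. apply (is_derive_comp B conv_y).
  + exact HB.
  + instantiate (1 := 5 / 13). unfold conv_y. auto_derive; [easy | field].
- unfold scal; simpl; unfold mult; simpl.
  set (E := exp (quad0 + 2601 / 800)).
  assert (HE : 0 < E * phi_dens y) by (apply Rmult_lt_0_compat; [apply exp_pos | apply phi_dens_pos]).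
  match goal with |- ?a <= ?b => assert (X : b - a = E * phi_dens y * (12 / 13) * ((conv_coef0 + conv_coef2) * - (d - y * mills y + 1))) by field end.
  assert (0 <= (conv_coef0 + conv_coef2) * - (d - y * mills y + 1)).
  { apply Rmult_le_pos; [apply Rlt_le, conv_coef_pos | lra]. }
  assert (0 <= E * phi_dens y * (12 / 13) * ((conv_coef0 + conv_coef2) * - (d - y * mills y + 1))).
  { apply Rmult_le_pos; [lra | assumption]. }
  lra.
Qed.

(** Serves the comparison at infinity, where the sign suffices. The Mills term is nonnegative;
    [conv_coef1] is negative, and 10 lies just beyond the zero of [conv_coef1 + conv_coef2 * y]. *)
Lemma conv_bound_nonneg (s : R) : 25 <= s -> 0 <= conv_bound s.
Proof.
intros Hs. unfold conv_bound.
assert (Hy : 10 <= conv_y s) by (unfold conv_y; lra).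
assert (Hm : 0 <= mills (conv_y s)).
{ unfold mills. set (y := conv_y s) in *.
  assert (P : forall n, 0 < y ^ n) by (intros; apply pow_lt; lra).
  apply Rlt_le, Rdiv_lt_0_compat.
  - generalize (P 6%nat) (P 4%nat) (P 2%nat); lra.
  - generalize (P 7%nat) (P 5%nat) (P 3%nat); lra. }
apply Rmult_le_pos; [|apply Rmult_le_pos].
- apply Rmult_le_pos; [lra | apply Rlt_le, exp_pos].
- apply Rlt_le, phi_dens_pos.
- assert (0 <= (conv_coef0 + conv_coef2) * mills (conv_y s)) by (apply Rmult_le_pos; [apply Rlt_le, conv_coef_pos | exact Hm]).
  assert (0 <= conv_coef1 + conv_coef2 * conv_y s); [|lra].
  apply Rle_trans with (conv_coef1 + conv_coef2 * 10); [unfold conv_coef1, conv_coef2; lra|].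
  apply Rplus_le_compat_l, Rmult_le_compat_l; [unfold conv_coef2; lra | exact Hy].
Qed.

(** * The subtracted integral as a function of the shift *)

(** The interval is bounded so that differentiation under the integral sign applies; the resulting
    bound does not depend on [l] and [r]. *)
Definition conv_int (l r s : R) : R := RInt (fun z => gauss_weight z * (1 - Phi (z + s))) l r.

Lemma is_derive_upper_tail_shift (z s : R) :
  is_derive (fun s => gauss_weight z * (1 - Phi (z + s))) s (- (gauss_weight z * phi_dens (z + s))).
Proof.
evar_last.
apply is_derive_scal.
apply (is_derive_minus (V := R_NormedModule) (fun _ => 1) (fun s => Phi (z + s))).
apply is_derive_const.
apply (is_derive_comp Phi (fun s => z + s)).
apply is_derive_Phi.
apply (is_derive_plus (V := R_NormedModule) (fun _ => z) (fun s => s)).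
apply is_derive_const. apply is_derive_id.
unfold minus, plus, opp, scal, zero, one; simpl; unfold mult; simpl. ring.
Qed.

Lemma continuous_gauss_weight_tail (s z : R) : continuous (fun z => gauss_weight z * (1 - Phi (z + s))) z.
Proof.
apply (continuous_mult (K := R_AbsRing) gauss_weight (fun z => 1 - Phi (z + s))).
apply continuous_gauss_weight.
apply (continuous_minus (V := R_NormedModule) (fun _ => 1) (fun z => Phi (z + s))).
apply continuous_const.
apply (continuous_comp (fun z => z + s) Phi).
apply (continuous_plus (V := R_NormedModule) (fun z => z) (fun _ => s)).
apply continuous_id. apply continuous_const.
apply continuous_Phi.
Qed.

Lemma ex_RInt_gauss_weight_tail (l r s : R) : ex_RInt (fun z => gauss_weight z * (1 - Phi (z + s))) l r.
Proof.
apply (ex_RInt_continuous (V := R_CompleteNormedModule)). intros; apply continuous_gauss_weight_tail.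
Qed.

Lemma is_derive_conv_int (l r s : R) :
  is_derive (conv_int l r) s (- RInt (fun z => gauss_weight z * phi_dens (z + s)) l r).
Proof.
assert (Ei : ex_RInt (fun z => gauss_weight z * phi_dens (z + s)) l r).
{ apply (ex_RInt_continuous (V := R_CompleteNormedModule)). intros z _.
  apply (continuous_mult (K := R_AbsRing) gauss_weight (fun z => phi_dens (z + s))).
  apply continuous_gauss_weight.
  apply (continuous_comp (fun z => z + s) phi_dens).
  apply (continuous_plus (V := R_NormedModule) (fun z => z) (fun _ => s)).
  apply continuous_id. apply continuous_const. apply continuous_phi_dens. }
replace (- RInt (fun z => gauss_weight z * phi_dens (z + s)) l r)
  with (RInt (fun z => Derive (fun s => gauss_weight z * (1 - Phi (z + s))) s) l r).
2:{ apply (is_RInt_unique (V := R_CompleteNormedModule)).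
    apply (is_RInt_ext (fun z => opp (gauss_weight z * phi_dens (z + s)))).
    { intros z _. symmetry. apply is_derive_unique, is_derive_upper_tail_shift. }
    apply (is_RInt_opp (V := R_NormedModule)), (RInt_correct (V := R_CompleteNormedModule)), Ei. }
apply (is_derive_RInt_param (fun s z => gauss_weight z * (1 - Phi (z + s))) l r s).
- apply filter_forall. intros y t _. eexists; apply is_derive_upper_tail_shift.
- intros t _.
  apply (continuity_2d_pt_ext (fun u v => - (gauss_weight v * phi_dens (v + u)))).
  { intros u v. symmetry. apply is_derive_unique, is_derive_upper_tail_shift. }
  apply continuity_2d_pt_opp, continuity_2d_pt_mult.
  + apply (continuity_1d_2d_pt_comp gauss_weight (fun _ v => v)).
    apply continuity_pt_filterlim, continuous_gauss_weight. apply continuity_2d_pt_id2.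
  + apply (continuity_1d_2d_pt_comp phi_dens (fun u v => v + u)).
    apply continuity_pt_filterlim, continuous_phi_dens.
    apply continuity_2d_pt_plus. apply continuity_2d_pt_id2. apply continuity_2d_pt_id1.
- apply filter_forall. intros y. apply ex_RInt_gauss_weight_tail.
Qed.

Lemma RInt_gauss_weight_conv_le (l r s : R) : l <= r ->
  RInt (fun z => gauss_weight z * phi_dens (z + s)) l r <=
  exp (quad0 + 2601 / 800) * phi_dens (conv_y s) * (12 / 13 * (conv_coef0 + conv_coef1 * conv_y s + conv_coef2 * conv_y s ^ 2)).
Proof.
intros Hlr.
set (k := exp (quad0 + 2601 / 800) * phi_dens (conv_y s)).
assert (E : RInt (fun z => gauss_weight z * phi_dens (z + s)) l r =
  k * RInt (fun z => mix_poly z * phi_dens (conv_x s z)) l r).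
{ apply (is_RInt_unique (V := R_CompleteNormedModule)).
  apply (is_RInt_ext (fun z => scal k (mix_poly z * phi_dens (conv_x s z)))).
  { intros z _. rewrite gauss_weight_conv. reflexivity. }
  apply (is_RInt_scal (V := R_NormedModule)), (RInt_correct (V := R_CompleteNormedModule)).
  apply (ex_RInt_continuous (V := R_CompleteNormedModule)).
  intros z _. apply (continuous_mult (K := R_AbsRing) mix_poly (fun z => phi_dens (conv_x s z))).
  - apply (ex_derive_continuous (K := R_AbsRing) (V := R_NormedModule)). unfold mix_poly. auto_derive; easy.
  - apply (continuous_comp (conv_x s) phi_dens); [|apply continuous_phi_dens].
    apply (ex_derive_continuous (K := R_AbsRing) (V := R_NormedModule)). unfold conv_x. auto_derive; easy. }
rewrite E. apply Rmult_le_compat_l.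
- apply Rlt_le, Rmult_lt_0_compat; [apply exp_pos | apply phi_dens_pos].
- now apply RInt_mix_poly_le.
Qed.

Lemma is_lim_conv_int (l r : R) : l <= r -> is_lim (conv_int l r) p_infty 0.
Proof.
intros Hlr.
assert (Hw : ex_RInt gauss_weight l r).
{ apply (ex_RInt_continuous (V := R_CompleteNormedModule)). intros; apply continuous_gauss_weight. }
apply (is_lim_le_le_loc (fun _ => 0) (fun s => RInt gauss_weight l r * (1 - Phi (s + l)))).
- exists 0. intros s _. split.
  + apply RInt_ge_0; [exact Hlr | apply ex_RInt_gauss_weight_tail |].
    intros z _. apply Rmult_le_pos; [apply Rlt_le, gauss_weight_pos | generalize (Phi_lt_1 (z + s)); lra].
  + replace (RInt gauss_weight l r * (1 - Phi (s + l))) with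
      (RInt (fun z => scal (1 - Phi (s + l)) (gauss_weight z)) l r).
    2:{ rewrite (RInt_scal (V := R_CompleteNormedModule)) by exact Hw. apply Rmult_comm. }
    apply RInt_le; [exact Hlr | apply ex_RInt_gauss_weight_tail | |].
    * apply (ex_RInt_scal (V := R_NormedModule)), Hw.
    * intros z Hz. unfold scal; simpl; unfold mult; simpl.
      assert (Phi (s + l) < Phi (z + s)) by (apply Phi_increasing; lra).
      generalize (gauss_weight_pos z). nra.
- apply is_lim_const.
- replace (Finite 0) with (Rbar_mult (RInt gauss_weight l r) 0) by (simpl; f_equal; ring).
  apply is_lim_scal_l.
  replace (Finite 0) with (Finite (1 - 1)) by (f_equal; ring).
  apply filterlim_one_minus; [typeclasses eauto|].
  apply (filterlim_ext (fun s => Phi (s - - l))). { intros s; f_equal; ring. }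
  apply (filterlim_Phi_shift (- l) p_infty 1); [apply is_lim_Phi_p_infty | now left].
Qed.

(** By the two derivative estimates [conv_int l r - conv_bound] is nondecreasing in the shift. At
    infinity [conv_int] tends to 0 while [conv_bound] is nonnegative, so the difference is at most 0
    everywhere. *)
Lemma conv_int_le (l r s : R) : l <= r -> 0 <= s -> conv_int l r s <= conv_bound s.
Proof.
intros Hlr Hs.
assert (Hm : forall t, s <= t -> conv_int l r s - conv_bound s <= conv_int l r t - conv_bound t).
{ intros t Ht.
  set (f := fun s => conv_int l r s - conv_bound s).
  assert (Hex : forall x, s <= x -> exists d, is_derive f x d /\ 0 <= d).
  { intros x Hx. destruct (conv_bound_derive x ltac:(lra)) as [d [Hd Hle]].
    eexists. split.
    - apply (is_derive_minus (V := R_NormedModule) (conv_int l r) conv_bound).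
      apply is_derive_conv_int. exact Hd.
    - unfold minus, plus, opp; simpl. generalize (RInt_gauss_weight_conv_le l r x Hlr). lra. }
  apply (le_of_derive_nonneg f (Derive f) s t Ht).
  - intros x Hx. destruct (Hex x (proj1 Hx)) as [d [Hd _]]. apply Derive_correct. now exists d.
  - intros x Hx. destruct (Hex x (proj1 Hx)) as [d [Hd Hp]]. now rewrite (is_derive_unique _ _ _ Hd). }
assert (conv_int l r s - conv_bound s <= 0); [|lra].
apply (is_lim_le_loc (fun _ => conv_int l r s - conv_bound s) (conv_int l r) p_infty (conv_int l r s - conv_bound s) 0).
- exists (Rmax s 25). intros t Ht.
  assert (s < t) by (generalize (Rmax_l s 25); lra).
  assert (25 < t) by (generalize (Rmax_r s 25); lra).
  generalize (Hm t ltac:(lra)) (conv_bound_nonneg t ltac:(lra)). lra.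
- apply is_lim_const.
- now apply is_lim_conv_int.
Qed.

(** * Numerical bounds *)

Lemma exp_opp_ge (t : R) : 0 <= t -> 1 - t + t ^ 2 / 2 - t ^ 3 / 6 <= exp (- t).
Proof.
intros Ht.
assert (H2 : forall s, 0 <= s -> exp (- s) <= 1 - s + s ^ 2 / 2).
{ intros s Hs.
  assert (1 - 0 + 0 ^ 2 / 2 - exp (- 0) <= 1 - s + s ^ 2 / 2 - exp (- s)).
  { apply (le_of_derive_nonneg (fun s => 1 - s + s ^ 2 / 2 - exp (- s)) (fun s => - 1 + s + exp (- s))); [exact Hs | |].
    - intros x _. auto_derive; [easy | field].
    - intros x _. generalize (exp_ineq1_le (- x)). lra. }
  rewrite Ropp_0, exp_0 in H. lra. }
assert (exp (- 0) - (1 - 0 + 0 ^ 2 / 2 - 0 ^ 3 / 6) <= exp (- t) - (1 - t + t ^ 2 / 2 - t ^ 3 / 6)).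
{ apply (le_of_derive_nonneg (fun t => exp (- t) - (1 - t + t ^ 2 / 2 - t ^ 3 / 6))
    (fun t => 1 - t + t ^ 2 / 2 - exp (- t))); [exact Ht | |].
  - intros x _. auto_derive; [easy | field].
  - intros x Hx. generalize (H2 x (proj1 Hx)). lra. }
rewrite Ropp_0, exp_0 in H. lra.
Qed.

Lemma exp_2571_2000_le : exp (2571 / 2000) <= 3.6167.
Proof.
(* The exponent is divided by 16, where the cubic Taylor bound is precise enough, and recovered by
   four squarings. *)
assert (H1 : 0.922797 <= exp (- (2571 / 32000))).
{ apply Rle_trans with (2 := exp_opp_ge (2571 / 32000) ltac:(lra)). lra. }
assert (S : forall a x, 0 <= a -> a <= exp (- x) -> a * a <= exp (- (2 * x))).
{ intros a x Ha H. replace (- (2 * x)) with (- x + - x) by ring. rewrite exp_plus.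
  now apply Rmult_le_compat. }
apply S in H1; [|lra]. apply S in H1; [|lra]. apply S in H1; [|lra]. apply S in H1; [|lra].
replace (2 * (2 * (2 * (2 * (2571 / 32000))))) with (2571 / 2000) in H1 by field.
rewrite exp_Ropp in H1.
assert (P := exp_pos (2571 / 2000)).
apply (Rmult_le_compat_r (exp (2571 / 2000))) in H1; [|lra].
rewrite Rinv_l in H1 by lra. lra.
Qed.

Lemma PI_ge : 3.1408 <= PI.
Proof.
destruct (PI_2_3_7_ineq 1) as [H _].
unfold tg_alt, PI_2_3_7_tg, Ratan_seq in H. simpl in H. lra.
Qed.

Lemma sqrt_2PI_ge : 2.5063 <= sqrt (2 * PI).
Proof.
apply Rsqr_incr_0; [| lra | apply Rlt_le, sqrt_2PI_pos].
rewrite Rsqr_sqrt by (generalize PI_ge; lra).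
unfold Rsqr. generalize PI_ge; lra.
Qed.

Lemma conv_bound_17_20 : conv_bound (17 / 20) <= 1.0002.
Proof.
unfold conv_bound.
replace (conv_y (17 / 20)) with (697 / 260) by (unfold conv_y; field).
set (br := conv_coef1 + conv_coef2 * (697 / 260) + (conv_coef0 + conv_coef2) * mills (697 / 260)).
(* Together with the bounds on the exponential and on sqrt(2 PI) this gives 12/5 * 0.28879 * 3.6167
   / 2.5063, which is below 1.0002. *)
assert (Hbr : 0 <= br <= 0.28879).
{ unfold br, conv_coef0, conv_coef1, conv_coef2, mills. lra. }
replace (12 / 5 * exp (quad0 + 2601 / 800) * (phi_dens (697 / 260) * br))
  with (12 / 5 * br * exp (2571 / 2000) / sqrt (2 * PI)).
2:{ replace (2571 / 2000) with (quad0 + 2601 / 800 + - (697 / 260) ^ 2 / 2) by (unfold quad0; field).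
    rewrite exp_plus. unfold phi_dens. unfold Rdiv. ring. }
assert (Hs := sqrt_2PI_ge). assert (He := exp_2571_2000_le). assert (P := exp_pos (2571 / 2000)).
apply Rmult_le_reg_r with (sqrt (2 * PI)); [lra|].
unfold Rdiv at 1. rewrite Rmult_assoc, Rinv_l by lra.
nra.
Qed.

(** * Integration of the minorant under N(mu,1) *)

Definition tail_prim : R -> R :=
  gauss_prim (1 + quad0) (17 / 16 + 2 / 5) (119 / 288 - 6 / 25 * (2 / 5) ^ 2) (11 / 150 * (2 / 5) ^ 3)
    (- (119 / 5000) * (2 / 5) ^ 4) (19 / 2500 * (2 / 5) ^ 5) (- (1 / 400) * (2 / 5) ^ 6).

Lemma is_derive_tail_prim (z : R) :
  is_derive tail_prim z ((1 + quad z + log_poly (2 / 5 * z)) * phi_dens z).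
Proof.
evar_last. apply is_derive_gauss_prim. unfold quad, log_poly. field.
Qed.

(** Under N(mu,1) the variable z = x - mu is standard normal and u = 1 - Phi(z + mu) <= 1 - Phi(z +
    17/20): this is the reduction to the shift 0.85. The change of variables from u to z is carried
    out as monotonicity in u of a combination of primitives. *)
Lemma lik_log_increment_ge (mu a c : R) : 0.85 < mu -> 0 < a -> a <= c -> c < 1 ->
  tail_prim (upper_quantile a - mu) - tail_prim (upper_quantile c - mu) - 1.0002
  <= lik_log mu c - lik_log mu a.
Proof.
intros Hmu Ha Hac Hc.
set (z := fun u => upper_quantile u - mu).
set (J := fun y => RInt (fun z => gauss_weight z * (1 - Phi (z + 17 / 20))) 0 y).
destruct (lik_log_spec mu ltac:(lra)) as [C [Hd _]].
assert (Hz : forall u, 0 < u < 1 -> is_derive z u (- / phi_dens (upper_quantile u))).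
{ intros u Hu. evar_last.
  apply (is_derive_minus (V := R_NormedModule) upper_quantile (fun _ => mu)).
  apply is_derive_upper_quantile, Hu. apply is_derive_const.
  unfold minus, plus, opp, zero; simpl. ring. }
assert (HJ : forall y, is_derive J y (gauss_weight y * (1 - Phi (y + 17 / 20)))).
{ intros y. apply (is_derive_RInt (V := R_NormedModule) (fun z => gauss_weight z * (1 - Phi (z + 17 / 20))) J 0).
  - apply filter_forall. intros x. apply (RInt_correct (V := R_CompleteNormedModule)), ex_RInt_gauss_weight_tail.
  - apply continuous_gauss_weight_tail. }
assert (Hm : lik_log mu a + tail_prim (z a) - J (z a) <= lik_log mu c + tail_prim (z c) - J (z c)).
{ apply (le_of_derive_nonneg (fun u => lik_log mu u + tail_prim (z u) - J (z u))
   (fun u => lik mu u * (- ln u - (1 + quad (z u) + log_poly (2 / 5 * z u)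
      - (1 - Phi (z u + 17 / 20)) * (exp (quad (z u)) * mix_poly (z u))))) a c Hac).
  - intros u Hu. assert (Hu1 : 0 < u < 1) by lra. evar_last.
    apply (is_derive_minus (V := R_NormedModule) (fun u => lik_log mu u + tail_prim (z u)) (fun u => J (z u))).
    apply (is_derive_plus (V := R_NormedModule) (lik_log mu) (fun u => tail_prim (z u))).
    apply Hd, Hu1.
    apply (is_derive_comp tail_prim z); [apply is_derive_tail_prim | apply Hz, Hu1].
    apply (is_derive_comp J z); [apply HJ | apply Hz, Hu1].
    unfold gauss_weight.
    (* The identity lik du = -phi(z) dz, which moves the integrals from u to z. *)
    replace (phi_dens (z u)) with (lik mu u * phi_dens (upper_quantile u)) by (unfold z; now rewrite phi_dens_shift).
    assert (P := phi_dens_pos (upper_quantile u)).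
    unfold minus, plus, opp, scal; simpl; unfold mult; simpl. field. lra.
  - intros u Hu. assert (Hu1 : 0 < u < 1) by lra.
    apply Rmult_le_pos; [apply Rlt_le, lik_pos|].
    assert (Hq := Phi_upper_quantile u Hu1).
    assert (Hlt : Phi (z u + 17 / 20) <= Phi (upper_quantile u)).
    { apply Rlt_le, Phi_increasing. unfold z. lra. }
    assert (Hl : ln u <= ln (1 - Phi (z u + 17 / 20))) by (apply ln_le; lra).
    assert (Hp : 0 < 1 - Phi (z u + 17 / 20)) by lra.
    generalize (opp_ln_ge (z u) _ Hp). lra. }
assert (Hzz : z c <= z a).
{ unfold z. destruct Hac as [Hac | ->]; [|lra].
  generalize (upper_quantile_decreasing a c Ha Hac Hc). lra. }
assert (HJJ : J (z a) - J (z c) <= 1.0002).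
{ apply Rle_trans with (2 := conv_bound_17_20).
  apply Rle_trans with (2 := conv_int_le (z c) (z a) (17 / 20) Hzz ltac:(lra)).
  apply Req_le. unfold J, conv_int.
  rewrite <- (RInt_Chasles (V := R_CompleteNormedModule) _ 0 (z c) (z a)) by apply ex_RInt_gauss_weight_tail.
  unfold plus; simpl. ring. }
unfold z in *. lra.
Qed.

Lemma lik_log_lim_gt_2 (mu L : R) : 0.85 < mu ->
  filterlim (lik_log mu) (at_left 1) (locally L) -> 2 < L.
Proof.
intros Hmu HL.
(* The Gaussian mean of [1 + quad z + log_poly (2 / 5 * z)], that is the total increment of
   [tail_prim] over the real line. The bound [c - 1.0002] on the limit then exceeds 2. *)
set (c := 1 + quad0 + (119 / 288 - 6 / 25 * (2 / 5) ^ 2) + 3 * (- (119 / 5000) * (2 / 5) ^ 4)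
          + 15 * (- (1 / 400) * (2 / 5) ^ 6)).
assert (Hc : 3.0003 < c) by (unfold c, quad0; lra).
destruct (lik_log_spec mu ltac:(lra)) as [C [_ [Hb _]]].
assert (Lz : forall x, x = p_infty \/ x = m_infty ->
  filterlim (fun y => y - mu) (Rbar_locally x) (Rbar_locally x)).
{ intros x [-> | ->] P [M HM]; exists (M + mu); intros y Hy; apply HM; lra. }
assert (H1 : forall t, 0 < t < 1 -> c - 1.0002 - tail_prim (upper_quantile t - mu) <= lik_log mu t).
{ intros t Ht.
  assert (c <= lik_log mu t + 1.0002 + tail_prim (upper_quantile t - mu)); [|lra].
  apply (filterlim_le (F := at_right 0) (fun a => tail_prim (upper_quantile a - mu))
    (fun _ => lik_log mu t + 1.0002 + tail_prim (upper_quantile t - mu)) c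
    (lik_log mu t + 1.0002 + tail_prim (upper_quantile t - mu))).
  - generalize (at_right_lt 0 t (proj1 Ht)). apply filter_imp. intros a Ha.
    generalize (lik_log_increment_ge mu a t Hmu (proj1 Ha) ltac:(lra) (proj2 Ht)) (Hb a ltac:(lra)). lra.
  - apply (filterlim_comp _ _ _ (fun a => upper_quantile a - mu) tail_prim _ (Rbar_locally p_infty)).
    + apply (filterlim_comp _ _ _ upper_quantile (fun y => y - mu) _ (Rbar_locally p_infty)).
      apply filterlim_upper_quantile_0. apply Lz; now left.
    + replace (Rbar_locally c) with (locally (c * 1)) by (now rewrite Rmult_1_r).
      apply filterlim_gauss_prim; [now left | apply is_lim_Phi_p_infty].
  - apply filterlim_const. }
assert (c <= L + 1.0002); [|lra].
apply (filterlim_le (F := at_left 1) (fun t => c - tail_prim (upper_quantile t - mu)) (fun t => lik_log mu t + 1.0002) c (L + 1.0002)).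
- generalize at_left_1_open_unit. apply filter_imp. intros t Ht. generalize (H1 t Ht). lra.
- replace (Rbar_locally c) with (locally (c - 0)) by (now rewrite Rminus_0_r).
  apply (filterlim_comp _ _ _ (fun t => tail_prim (upper_quantile t - mu)) (fun y => c - y) _ (locally 0)).
  + apply (filterlim_comp _ _ _ (fun a => upper_quantile a - mu) tail_prim _ (Rbar_locally m_infty)).
    * apply (filterlim_comp _ _ _ upper_quantile (fun y => y - mu) _ (Rbar_locally m_infty)).
      apply filterlim_upper_quantile_1. apply Lz; now right.
    * replace (locally 0) with (locally (c * 0)) by (f_equal; ring).
      apply filterlim_gauss_prim; [now right | apply is_lim_Phi_m_infty].
  + apply (continuous_minus (V := R_NormedModule) (fun _ => c) (fun y => y)).
    apply continuous_const. apply continuous_id.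
- apply (filterlim_comp _ _ _ (lik_log mu) (fun y => y + 1.0002) _ (locally L)); [exact HL|].
  apply (continuous_plus (V := R_NormedModule) (fun y => y) (fun _ => 1.0002)).
  apply continuous_id. apply continuous_const.
Qed.

(** * The diagonal equation *)

Lemma is_derive_div_sqrt_0 (n v : R -> R) (x dn dv : R) :
  is_derive n x dn -> is_derive v x dv -> 0 < v x -> dn * v x = n x * dv / 2 ->
  is_derive (fun y => n y / sqrt (v y)) x 0.
Proof.
intros Hn Hv Hpos E.
assert (Hs : 0 < sqrt (v x)) by (apply sqrt_lt_R0, Hpos).
evar_last.
apply is_derive_div; [exact Hn | apply is_derive_sqrt; [exact Hv | exact Hpos] | lra].
assert (S : sqrt (v x) * sqrt (v x) = v x) by (apply sqrt_sqrt; lra).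
assert (Z : dn * (sqrt (v x) * sqrt (v x)) - n x * dv / 2 = 0) by (rewrite S; lra).
transitivity ((dn * (sqrt (v x) * sqrt (v x)) - n x * dv / 2) / sqrt (v x) ^ 3).
- simpl. field. lra.
- rewrite Z. unfold Rdiv. ring.
Qed.

Lemma filterlim_Rmult {T : Type} (F : (T -> Prop) -> Prop) {FF : Filter F} (f g : T -> R) (a b : R) :
  filterlim f F (locally a) -> filterlim g F (locally b) ->
  filterlim (fun x => f x * g x) F (locally (a * b)).
Proof.
intros Hf Hg. eapply (filterlim_comp_2 f g Rmult); [exact Hf | exact Hg |].
apply (filterlim_mult (K := R_AbsRing)).
Qed.

Lemma filterlim_Rplus {T : Type} (F : (T -> Prop) -> Prop) {FF : Filter F} (f g : T -> R) (a b : R) :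
  filterlim f F (locally a) -> filterlim g F (locally b) ->
  filterlim (fun x => f x + g x) F (locally (a + b)).
Proof.
intros Hf Hg. eapply (filterlim_comp_2 f g Rplus); [exact Hf | exact Hg |].
apply (filterlim_plus (V := R_NormedModule)).
Qed.

Lemma filterlim_Ropp {T : Type} (F : (T -> Prop) -> Prop) {FF : Filter F} (f : T -> R) (a : R) :
  filterlim f F (locally a) -> filterlim (fun x => - f x) F (locally (- a)).
Proof.
intros Hf. eapply (filterlim_comp _ _ _ f Ropp); [exact Hf|].
apply (filterlim_opp (V := R_NormedModule)).
Qed.

Lemma filterlim_Rminus {T : Type} (F : (T -> Prop) -> Prop) {FF : Filter F} (f g : T -> R) (a b : R) :
  filterlim f F (locally a) -> filterlim g F (locally b) ->
  filterlim (fun x => f x - g x) F (locally (a - b)).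
Proof. intros Hf Hg. apply filterlim_Rplus; [typeclasses eauto | exact Hf | now apply filterlim_Ropp]. Qed.

Lemma filterlim_at_left_continuous (f : R -> R) (x : R) :
  continuous f x -> filterlim f (at_left x) (locally (f x)).
Proof.
intros H. apply (filterlim_filter_le_1 (F := locally x) (G := at_left x) (H := locally (f x))).
- apply filter_le_within.
- exact H.
Qed.

Lemma nonneg_of_derive (F dF : R -> R) :
  filterlim F (at_right 0) (locally 0) ->
  (forall u, 0 < u < 1 -> is_derive F u (dF u)) ->
  (forall u, 0 < u < 1 -> 0 <= dF u) ->
  forall t, 0 < t < 1 -> 0 <= F t.
Proof.
intros L Hd Hp t Ht.
apply (filterlim_le (F := at_right 0) F (fun _ => F t) 0 (F t)).
- generalize (at_right_lt 0 t (proj1 Ht)). apply filter_imp. intros y Hy.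
  apply (le_of_derive_nonneg F dF y t); [lra | |].
  + intros; apply Hd; lra.
  + intros; apply Hp; lra.
- exact L.
- apply filterlim_const.
Qed.

Lemma Rpower_le_exponent (t a b : R) : 0 < t < 1 -> a <= b -> Rpower t b <= Rpower t a.
Proof.
intros Ht [Hab | ->]; [|lra].
apply Rlt_le, exp_increasing.
assert (ln t < 0) by (apply ln_neg; lra). nra.
Qed.

Lemma mul_log_bound (t : R) : 0 < t < 1 -> t * (1 + ln t ^ 2) <= 257 * Rpower t (3 / 4).
Proof.
intros Ht. assert (H := sqr_ln_le_Rpower t Ht).
apply Rle_trans with (257 * Rpower t (7 / 8)).
- replace (Rpower t (7 / 8)) with (t * Rpower t (- (1 / 8))).
  2:{ rewrite <- (Rpower_1 t) at 1 by lra. rewrite <- Rpower_plus. f_equal. field. }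
  nra.
- generalize (Rpower_le_exponent t (3 / 4) (7 / 8) Ht ltac:(lra)). lra.
Qed.

Lemma is_derive_mul_ln (t : R) : 0 < t -> is_derive (fun t => t * ln t - t) t (ln t).
Proof. intros Ht. auto_derive; [exact Ht | field; lra]. Qed.

Lemma is_derive_mul_ln2 (t : R) : 0 < t ->
  is_derive (fun t => t * ln t ^ 2 - 2 * t * ln t + 2 * t) t (ln t ^ 2).
Proof. intros Ht. auto_derive; [auto | field; lra]. Qed.

Lemma mul_ln_abs_le (t : R) : 0 < t < 1 -> Rabs (t * ln t - t) <= 514 * Rpower t (3 / 4).
Proof.
intros Ht. assert (H := mul_log_bound t Ht).
assert (ln t < 0) by (apply ln_neg; lra).
assert (0 <= t * (ln t + 1) ^ 2) by (apply Rmult_le_pos; [lra | apply pow2_ge_0]).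
assert (0 <= t * (ln t - 1) ^ 2) by (apply Rmult_le_pos; [lra | apply pow2_ge_0]).
assert (0 <= t * ln t ^ 2) by (apply Rmult_le_pos; [lra | apply pow2_ge_0]).
apply Rabs_le. split; lra.
Qed.

Lemma mul_ln2_abs_le (t : R) : 0 < t < 1 ->
  Rabs (t * ln t ^ 2 - 2 * t * ln t + 2 * t) <= 771 * Rpower t (3 / 4).
Proof.
intros Ht. assert (H := mul_log_bound t Ht).
assert (ln t < 0) by (apply ln_neg; lra).
assert (0 <= t * (ln t + 1) ^ 2) by (apply Rmult_le_pos; [lra | apply pow2_ge_0]).
assert (0 <= t * (ln t - 1) ^ 2) by (apply Rmult_le_pos; [lra | apply pow2_ge_0]).
assert (0 <= t * ln t ^ 2) by (apply Rmult_le_pos; [lra | apply pow2_ge_0]).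
apply Rabs_le. split; lra.
Qed.

(** * The mixture distribution *)

Definition mix_dens (mu eps u : R) : R := 1 - eps + eps * lik mu u.

(** [mix_log] and [mix_log2] are the primitives vanishing at 0 of [ln u] and [ln u ^ 2] times
    [mix_dens], split into the closed form for the uniform part and the contribution of the signal.
    On (0,1) they are the two integrals in [V1]. *)
Definition mix_log (mu eps t : R) : R := (1 - eps) * (t * ln t - t) + eps * - lik_log mu t.

Definition mix_log2 (mu eps t : R) : R :=
  (1 - eps) * (t * ln t ^ 2 - 2 * t * ln t + 2 * t) + eps * lik_log2 mu t.

Lemma mix_dens_pos (mu eps u : R) : 0 < eps < 1 -> 0 < mix_dens mu eps u.
Proof. intros He. unfold mix_dens. generalize (lik_pos mu u). nra. Qed.

Lemma is_derive_D (mu eps u : R) : 0 < u < 1 -> is_derive (D mu eps) u (mix_dens mu eps u).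
Proof.
intros Hu. unfold D, mix_dens. evar_last.
apply (is_derive_plus (V := R_NormedModule) (fun x => (1 - eps) * x) (fun x => eps * alt_cdf mu x)).
apply is_derive_scal, is_derive_id.
apply is_derive_scal, is_derive_alt_cdf, Hu.
unfold plus, one; simpl. ring.
Qed.

Lemma Dp_eq (mu eps u : R) : 0 < u < 1 -> Dp mu eps u = mix_dens mu eps u.
Proof. intros Hu. apply is_derive_unique, is_derive_D, Hu. Qed.

Lemma continuous_Dp (mu eps u : R) : 0 < u < 1 -> continuous (Dp mu eps) u.
Proof.
intros Hu. apply (continuous_ext_loc _ (mix_dens mu eps)).
- generalize (locally_open_interval 0 1 u Hu). apply filter_imp. intros y Hy. symmetry; now apply Dp_eq.
- apply (continuous_plus (V := R_NormedModule) (fun _ => 1 - eps) (fun u => eps * lik mu u)).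
  apply continuous_const.
  apply (continuous_mult (K := R_AbsRing) (fun _ => eps) (lik mu)).
  apply continuous_const. now apply continuous_lik.
Qed.

Lemma is_derive_mix_log (mu eps u : R) : 0 < mu -> 0 < u < 1 ->
  is_derive (mix_log mu eps) u (ln u * mix_dens mu eps u).
Proof.
intros Hmu Hu. destruct (lik_log_spec mu Hmu) as [C [Hd _]].
unfold mix_log, mix_dens. evar_last.
apply (is_derive_plus (V := R_NormedModule) (fun t => (1 - eps) * (t * ln t - t)) (fun t => eps * - lik_log mu t)).
apply is_derive_scal, is_derive_mul_ln, Hu.
apply is_derive_scal, (is_derive_opp (V := R_NormedModule)), Hd, Hu.
unfold plus, opp; simpl. ring.
Qed.

Lemma is_derive_mix_log2 (mu eps u : R) : 0 < mu -> 0 < u < 1 ->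
  is_derive (mix_log2 mu eps) u (ln u ^ 2 * mix_dens mu eps u).
Proof.
intros Hmu Hu. destruct (lik_log2_spec mu Hmu) as [C [Hd _]].
unfold mix_log2, mix_dens. evar_last.
apply (is_derive_plus (V := R_NormedModule) (fun t => (1 - eps) * (t * ln t ^ 2 - 2 * t * ln t + 2 * t)) (fun t => eps * lik_log2 mu t)).
apply is_derive_scal, is_derive_mul_ln2, Hu.
apply is_derive_scal, Hd, Hu.
unfold plus; simpl. ring.
Qed.

Lemma mix_bounds (mu eps : R) : 0 < mu -> 0 < eps < 1 -> exists C, 0 < C /\
  forall t, 0 < t < 1 ->
  Rabs (D mu eps t) <= C * Rpower t (3 / 4) /\
  Rabs (mix_log mu eps t) <= C * Rpower t (3 / 4) /\
  Rabs (mix_log2 mu eps t) <= C * Rpower t (3 / 4).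
Proof.
intros Hmu He.
destruct (alt_cdf_le_Rpower mu Hmu) as [C0 H0].
destruct (lik_log_spec mu Hmu) as [C1 [_ [H1 _]]].
destruct (lik_log2_spec mu Hmu) as [C2 [_ [H2 _]]].
exists (Rabs C0 + Rabs C1 + Rabs C2 + 1285). split.
{ generalize (Rabs_pos C0) (Rabs_pos C1) (Rabs_pos C2). lra. }
intros t Ht.
specialize (H0 t Ht). specialize (H1 t Ht). specialize (H2 t Ht).
assert (Ha := alt_cdf_gt mu t Hmu Ht).
assert (L1 := mul_ln_abs_le t Ht). assert (L2 := mul_ln2_abs_le t Ht).
assert (P : 0 < Rpower t (3 / 4)) by apply exp_pos.
set (p := Rpower t (3 / 4)) in *.
assert (K0 : C0 * p <= Rabs C0 * p) by (generalize (Rle_abs C0); nra).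
assert (K1 : C1 * p <= Rabs C1 * p) by (generalize (Rle_abs C1); nra).
assert (K2 : C2 * p <= Rabs C2 * p) by (generalize (Rle_abs C2); nra).
assert (Q0 : 0 <= Rabs C0 * p) by (apply Rmult_le_pos; [apply Rabs_pos | lra]).
assert (Q1 : 0 <= Rabs C1 * p) by (apply Rmult_le_pos; [apply Rabs_pos | lra]).
assert (Q2 : 0 <= Rabs C2 * p) by (apply Rmult_le_pos; [apply Rabs_pos | lra]).
apply Rabs_le_between in L1. apply Rabs_le_between in L2.
rewrite !Rmult_plus_distr_r.
repeat split; apply Rabs_le.
- unfold D. fold (alt_cdf mu t). split; nra.
- unfold mix_log. split; nra.
- unfold mix_log2. split; nra.
Qed.

Lemma filterlim_D_0 (mu eps : R) : 0 < mu -> 0 < eps < 1 ->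
  filterlim (D mu eps) (at_right 0) (locally 0).
Proof.
intros Hmu He. destruct (mix_bounds mu eps Hmu He) as [C [_ H]].
apply filterlim_0_of_Rpower_bound with C (3 / 4); [lra | intros; now apply H].
Qed.

Lemma filterlim_mix_log_0 (mu eps : R) : 0 < mu -> 0 < eps < 1 ->
  filterlim (mix_log mu eps) (at_right 0) (locally 0).
Proof.
intros Hmu He. destruct (mix_bounds mu eps Hmu He) as [C [_ H]].
apply filterlim_0_of_Rpower_bound with C (3 / 4); [lra | intros; now apply H].
Qed.

Lemma filterlim_mix_log2_0 (mu eps : R) : 0 < mu -> 0 < eps < 1 ->
  filterlim (mix_log2 mu eps) (at_right 0) (locally 0).
Proof.
intros Hmu He. destruct (mix_bounds mu eps Hmu He) as [C [_ H]].
apply filterlim_0_of_Rpower_bound with C (3 / 4); [lra | intros; now apply H].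
Qed.

Lemma I0_log_Dp (mu eps t : R) : 0 < mu -> 0 < eps < 1 -> 0 < t < 1 ->
  I0 (fun u => ln u * Dp mu eps u) t = mix_log mu eps t.
Proof.
intros Hmu He Ht. apply I0_primitive; [exact Ht | | |now apply filterlim_mix_log_0].
- intros u Hu. rewrite Dp_eq by exact Hu. now apply is_derive_mix_log.
- intros u Hu. apply (continuous_mult (K := R_AbsRing) ln (Dp mu eps)).
  apply continuous_ln, Hu. now apply continuous_Dp.
Qed.

Lemma I0_log2_Dp (mu eps t : R) : 0 < mu -> 0 < eps < 1 -> 0 < t < 1 ->
  I0 (fun u => ln u ^ 2 * Dp mu eps u) t = mix_log2 mu eps t.
Proof.
intros Hmu He Ht. apply I0_primitive; [exact Ht | | |now apply filterlim_mix_log2_0].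
- intros u Hu. rewrite Dp_eq by exact Hu. now apply is_derive_mix_log2.
- intros u Hu. apply (continuous_mult (K := R_AbsRing) (fun u => ln u ^ 2) (Dp mu eps)).
  apply (ex_derive_continuous (K := R_AbsRing) (V := R_NormedModule)). auto_derive; apply Hu.
  now apply continuous_Dp.
Qed.

Lemma E1_eq (mu eps t1 t2 : R) : 0 < mu -> 0 < eps < 1 -> 0 < t1 < 1 -> 0 < t2 ->
  E1 mu eps t1 t2 = ln t2 * D mu eps t1 - mix_log mu eps t1.
Proof.
intros Hmu He Ht1 Ht2. unfold E1.
apply (I0_primitive _ (fun t => ln t2 * D mu eps t - mix_log mu eps t)); [exact Ht1 | | |].
- intros u Hu. rewrite Dp_eq, ln_div by lra. evar_last.
  apply (is_derive_minus (V := R_NormedModule) (fun t => ln t2 * D mu eps t) (mix_log mu eps)).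
  apply is_derive_scal, is_derive_D, Hu. now apply is_derive_mix_log.
  unfold minus, plus, opp; simpl. ring.
- intros u Hu. apply (continuous_mult (K := R_AbsRing) (fun u => - ln (u / t2)) (Dp mu eps)).
  + apply (ex_derive_continuous (K := R_AbsRing) (V := R_NormedModule)). auto_derive.
    apply Rdiv_lt_0_compat; lra.
  + now apply continuous_Dp.
- replace (locally 0) with (locally (ln t2 * 0 - 0)) by (f_equal; ring).
  apply filterlim_Rminus; [typeclasses eauto | |now apply filterlim_mix_log_0].
  apply filterlim_Rmult; [typeclasses eauto | apply filterlim_const | now apply filterlim_D_0].
Qed.

(** Removes the improper integrals: what remains are differentiable functions of [t1] combined with
    [ln t2]. *)
Lemma b_eq (mu eps t1 t2 : R) : 0 < mu -> 0 < eps < 1 -> 0 < t1 < 1 -> 0 < t2 ->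
  b mu eps t1 t2 =
  (ln t2 * D mu eps t1 - mix_log mu eps t1 - t1 * (1 - ln t1 + ln t2)) /
  sqrt (mix_log2 mu eps t1 - mix_log mu eps t1 ^ 2
        + 2 * (D mu eps t1 - 1) * ln t2 * mix_log mu eps t1
        + ln t2 ^ 2 * D mu eps t1 * (1 - D mu eps t1)).
Proof.
intros Hmu He Ht1 Ht2. unfold b, Delta, V1, E0.
now rewrite E1_eq, I0_log_Dp, I0_log2_Dp.
Qed.

(** * Truncated moments on the diagonal *)

(** The m1 and m2 of the overview, expanded by -ln(u/t) = ln t - ln u. *)
Definition moment1 (mu eps t : R) : R := ln t * D mu eps t - mix_log mu eps t.
Definition moment2 (mu eps t : R) : R :=
  ln t ^ 2 * D mu eps t - 2 * ln t * mix_log mu eps t + mix_log2 mu eps t.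
(* Up to a positive factor, the derivative of [b mu eps t] at [t]; the variance [V1] on the diagonal is
   [moment2 - moment1 ^ 2]. *)
Definition diag_crit (mu eps t : R) : R :=
  (D mu eps t - t) * (moment2 mu eps t - moment1 mu eps t ^ 2)
  - (moment1 mu eps t - t) * (1 - D mu eps t) * moment1 mu eps t.

(** The integrand -ln(u/t) vanishes at the endpoint u = t, so only the [t] inside the logarithm
    contributes, with derivative 1/t. The same mechanism lowers the order by one for [moment2]. *)
Lemma is_derive_moment1 (mu eps t : R) : 0 < mu -> 0 < t < 1 ->
  is_derive (moment1 mu eps) t (D mu eps t / t).
Proof.
intros Hmu Ht. assert (HD := is_derive_D mu eps t Ht). assert (H1 := is_derive_mix_log mu eps t Hmu Ht).
unfold moment1. evar_last.
apply (is_derive_minus (V := R_NormedModule) (fun t => ln t * D mu eps t) (mix_log mu eps)).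
apply (is_derive_mult (K := R_AbsRing) ln (D mu eps)).
apply is_derive_ln, Ht. exact HD. intros; apply Rmult_comm.
exact H1.
unfold minus, plus, opp, mult; simpl. field. lra.
Qed.

Lemma is_derive_moment2 (mu eps t : R) : 0 < mu -> 0 < t < 1 ->
  is_derive (moment2 mu eps) t (2 * moment1 mu eps t / t).
Proof.
intros Hmu Ht. assert (HD := is_derive_D mu eps t Ht). assert (H1 := is_derive_mix_log mu eps t Hmu Ht).
assert (H2 := is_derive_mix_log2 mu eps t Hmu Ht).
assert (Hl := is_derive_ln t (proj1 Ht)).
unfold moment2, moment1. evar_last.
apply (is_derive_plus (V := R_NormedModule) (fun t => ln t ^ 2 * D mu eps t - 2 * ln t * mix_log mu eps t) (mix_log2 mu eps)).
apply (is_derive_minus (V := R_NormedModule) (fun t => ln t ^ 2 * D mu eps t) (fun t => 2 * ln t * mix_log mu eps t)).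
apply (is_derive_mult (K := R_AbsRing) (fun t => ln t ^ 2) (D mu eps)).
apply is_derive_pow, Hl. exact HD. intros; apply Rmult_comm.
apply (is_derive_mult (K := R_AbsRing) (fun t => 2 * ln t) (mix_log mu eps)).
apply is_derive_scal, Hl. exact H1. intros; apply Rmult_comm.
exact H2.
unfold minus, plus, opp, mult; simpl. field. lra.
Qed.

(** The factors [ln t] and [ln t ^ 2] cost an exponent 1/8. The remaining 5/8 still exceeds 1/2, as
    the comparison with sqrt t in [exists_moment1_lt] demands. *)
Lemma moment_bounds (mu eps : R) : 0 < mu -> 0 < eps < 1 -> exists C, 0 < C /\
  forall t, 0 < t < 1 ->
  Rabs (moment1 mu eps t) <= C * Rpower t (5 / 8) /\ Rabs (moment2 mu eps t) <= C * Rpower t (5 / 8).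
Proof.
intros Hmu He. destruct (mix_bounds mu eps Hmu He) as [C [HC H]].
(* Four times the 257 of [sqr_ln_le_Rpower]: the coefficients of [moment2] are 1, 2 and 1 in
   absolute value. *)
exists (1028 * C). split; [lra|]. intros t Ht.
destruct (H t Ht) as [HD [H1 H2]]. clear H.
assert (P : 0 < Rpower t (3 / 4)) by apply exp_pos.
assert (R0 : Rpower t (5 / 8) = Rpower t (- (1 / 8)) * Rpower t (3 / 4)).
{ rewrite <- Rpower_plus. f_equal. field. }
assert (L := sqr_ln_le_Rpower t Ht).
assert (Hln : ln t < 0) by (apply ln_neg; lra).
rewrite R0.
set (p := Rpower t (3 / 4)) in *. set (q := Rpower t (- (1 / 8))) in *.
assert (Hcp : 0 < C * p) by (apply Rmult_lt_0_compat; lra).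
assert (Hl1 : Rabs (ln t) <= 257 * q).
{ rewrite Rabs_left by lra. generalize (pow2_ge_0 (ln t + 1 / 2)). nra. }
assert (Hl2 : ln t ^ 2 <= 257 * q) by lra.
assert (Hq : 1 <= 257 * q) by (generalize (pow2_ge_0 (ln t)); lra).
assert (B1 : Rabs (ln t * D mu eps t) <= 257 * q * (C * p)).
{ rewrite Rabs_mult. apply Rmult_le_compat; try apply Rabs_pos; assumption. }
assert (B2 : Rabs (ln t * mix_log mu eps t) <= 257 * q * (C * p)).
{ rewrite Rabs_mult. apply Rmult_le_compat; try apply Rabs_pos; assumption. }
assert (B3 : Rabs (ln t ^ 2 * D mu eps t) <= 257 * q * (C * p)).
{ rewrite Rabs_mult, (Rabs_pos_eq (ln t ^ 2)) by apply pow2_ge_0.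
  apply Rmult_le_compat; try assumption. apply pow2_ge_0. apply Rabs_pos. }
assert (B4 : C * p <= 257 * q * (C * p)) by nra.
apply Rabs_le_between in B1. apply Rabs_le_between in B2. apply Rabs_le_between in B3.
apply Rabs_le_between in H1. apply Rabs_le_between in H2.
unfold moment1, moment2. split; apply Rabs_le; split; lra.
Qed.

Lemma filterlim_moment1_0 (mu eps : R) : 0 < mu -> 0 < eps < 1 ->
  filterlim (moment1 mu eps) (at_right 0) (locally 0).
Proof.
intros Hmu He. destruct (moment_bounds mu eps Hmu He) as [C [_ H]].
apply filterlim_0_of_Rpower_bound with C (5 / 8); [lra | intros; now apply H].
Qed.

Lemma filterlim_moment2_0 (mu eps : R) : 0 < mu -> 0 < eps < 1 ->
  filterlim (moment2 mu eps) (at_right 0) (locally 0).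
Proof.
intros Hmu He. destruct (moment_bounds mu eps Hmu He) as [C [_ H]].
apply filterlim_0_of_Rpower_bound with C (5 / 8); [lra | intros; now apply H].
Qed.

Lemma D_bounds (mu eps t : R) : 0 < mu -> 0 < eps < 1 -> 0 < t < 1 -> t < D mu eps t < 1.
Proof.
intros Hmu He Ht. assert (H := alt_cdf_gt mu t Hmu Ht).
unfold D. fold (alt_cdf mu t). nra.
Qed.

(** The difference has derivative D/t - D', the slope of the chord from 0 minus that of the tangent,
    nonnegative by concavity. *)
Lemma moment1_ge_D (mu eps t : R) : 0 < mu -> 0 < eps < 1 -> 0 < t < 1 -> D mu eps t <= moment1 mu eps t.
Proof.
intros Hmu He Ht. assert (0 <= moment1 mu eps t - D mu eps t); [|lra].
apply (nonneg_of_derive (fun t => moment1 mu eps t - D mu eps t) (fun t => D mu eps t / t - mix_dens mu eps t)); [| | |exact Ht].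
- replace (locally 0) with (locally (0 - 0)) by (f_equal; ring).
  apply filterlim_Rminus; [typeclasses eauto | now apply filterlim_moment1_0 | now apply filterlim_D_0].
- intros u Hu. apply (is_derive_minus (V := R_NormedModule) (moment1 mu eps) (D mu eps)).
  now apply is_derive_moment1. now apply is_derive_D.
- intros u Hu. assert (H := alt_cdf_concave_0 mu u Hmu Hu).
  assert (u * mix_dens mu eps u <= D mu eps u).
  { unfold mix_dens, D. fold (alt_cdf mu u). nra. }
  assert (mix_dens mu eps u <= D mu eps u / u); [|lra].
  apply Rmult_le_reg_r with u; [lra|]. unfold Rdiv. rewrite Rmult_assoc, Rinv_l by lra. lra.
Qed.

(** The difference has derivative 2 (m1 - D)/t, so the previous inequality integrates to this
    one. *)
Lemma moment2_ge_moment1 (mu eps t : R) : 0 < mu -> 0 < eps < 1 -> 0 < t < 1 -> 2 * moment1 mu eps t <= moment2 mu eps t.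
Proof.
intros Hmu He Ht. assert (0 <= moment2 mu eps t - 2 * moment1 mu eps t); [|lra].
apply (nonneg_of_derive (fun t => moment2 mu eps t - 2 * moment1 mu eps t)
  (fun t => 2 * moment1 mu eps t / t - 2 * (D mu eps t / t))); [| | |exact Ht].
- replace (locally 0) with (locally (0 - 2 * 0)) by (f_equal; ring).
  apply filterlim_Rminus; [typeclasses eauto | now apply filterlim_moment2_0 |].
  apply filterlim_Rmult; [typeclasses eauto | apply filterlim_const | now apply filterlim_moment1_0].
- intros u Hu. apply (is_derive_minus (V := R_NormedModule) (moment2 mu eps) (fun t => 2 * moment1 mu eps t)).
  now apply is_derive_moment2. now apply is_derive_scal, is_derive_moment1.
- intros u Hu. assert (H := moment1_ge_D mu eps u Hmu He Hu).
  replace (2 * moment1 mu eps u / u - 2 * (D mu eps u / u)) with (2 * (moment1 mu eps u - D mu eps u) * / u) by (field; lra).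
  apply Rmult_le_pos; [lra | apply Rlt_le, Rinv_0_lt_compat, Hu].
Qed.

(* The derivative of the difference collapses to [mix_dens * moment2]. *)
Lemma moment1_sqr_le (mu eps t : R) : 0 < mu -> 0 < eps < 1 -> 0 < t < 1 ->
  moment1 mu eps t ^ 2 <= D mu eps t * moment2 mu eps t.
Proof.
intros Hmu He Ht. assert (0 <= D mu eps t * moment2 mu eps t - moment1 mu eps t ^ 2); [|lra].
apply (nonneg_of_derive (fun t => D mu eps t * moment2 mu eps t - moment1 mu eps t ^ 2)
  (fun t => mix_dens mu eps t * moment2 mu eps t)); [| | |exact Ht].
- replace (locally 0) with (locally (0 * 0 - 0 * (0 * 1))) by (f_equal; ring).
  apply filterlim_Rminus; [typeclasses eauto | |].
  + apply filterlim_Rmult; [typeclasses eauto | now apply filterlim_D_0 | now apply filterlim_moment2_0].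
  + apply filterlim_Rmult; [typeclasses eauto | now apply filterlim_moment1_0 |].
    apply filterlim_Rmult; [typeclasses eauto | now apply filterlim_moment1_0 | apply filterlim_const].
- intros u Hu. evar_last.
  apply (is_derive_minus (V := R_NormedModule) (fun t => D mu eps t * moment2 mu eps t) (fun t => moment1 mu eps t ^ 2)).
  apply (is_derive_mult (K := R_AbsRing) (D mu eps) (moment2 mu eps)).
  now apply is_derive_D. now apply is_derive_moment2. intros; apply Rmult_comm.
  now apply is_derive_pow, is_derive_moment1.
  unfold minus, plus, opp, mult; simpl. field. lra.
- intros u Hu. apply Rmult_le_pos; [now apply Rlt_le, mix_dens_pos|].
  generalize (moment2_ge_moment1 mu eps u Hmu He Hu) (moment1_ge_D mu eps u Hmu He Hu) (D_bounds mu eps u Hmu He Hu). lra.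
Qed.

(** By the Cauchy-Schwarz bound m1^2 <= D m2, and this is strictly below m2 because D < 1 and m2 >
    0. *)
Lemma variance_pos (mu eps t : R) : 0 < mu -> 0 < eps < 1 -> 0 < t < 1 ->
  0 < moment2 mu eps t - moment1 mu eps t ^ 2.
Proof.
intros Hmu He Ht.
generalize (moment2_ge_moment1 mu eps t Hmu He Ht) (moment1_ge_D mu eps t Hmu He Ht) (D_bounds mu eps t Hmu He Ht)
  (moment1_sqr_le mu eps t Hmu He Ht). intros. nra.
Qed.

(* Otherwise [(moment1 t - t) / sqrt t] would be nonincreasing with limit 0 at 0. *)
Lemma exists_moment1_lt (mu eps : R) : 0 < mu -> 0 < eps < 1 ->
  exists t, 0 < t < 1 /\ moment1 mu eps t < 2 * D mu eps t - t.
Proof.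
intros Hmu He. apply Classical_Prop.NNPP. intros N.
assert (H : forall t, 0 < t < 1 -> 2 * D mu eps t - t <= moment1 mu eps t).
{ intros t Ht. apply Rnot_lt_le. intros L. apply N. now exists t. }
set (f := fun t => - ((moment1 mu eps t - t) * Rpower t (- (1 / 2)))).
assert (Hf : 0 <= f (1 / 2)).
{ apply (nonneg_of_derive f (fun t => - ((D mu eps t / t - 1) * Rpower t (- (1 / 2))
     + (moment1 mu eps t - t) * (- (1 / 2) * Rpower t (- (1 / 2) - 1))))); [| | |lra].
  - destruct (moment_bounds mu eps Hmu He) as [C [HC Hb]].
    apply filterlim_0_of_Rpower_bound with (C + 1) (1 / 8); [lra|].
    intros u Hu. destruct (Hb u Hu) as [Hb1 _].
    unfold f. rewrite Rabs_Ropp, Rabs_mult, (Rabs_pos_eq (Rpower u (- (1 / 2)))) by apply Rlt_le, exp_pos.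
    replace (Rpower u (1 / 8)) with (Rpower u (5 / 8) * Rpower u (- (1 / 2))).
    2:{ rewrite <- Rpower_plus. f_equal. field. }
    rewrite <- Rmult_assoc. apply Rmult_le_compat_r; [apply Rlt_le, exp_pos|].
    assert (Hu1 : u <= Rpower u (5 / 8)).
    { rewrite <- (Rpower_1 u) at 1 by lra. apply Rpower_le_exponent; lra. }
    apply Rle_trans with (1 := Rabs_triang (moment1 mu eps u) (- u)).
    rewrite Rabs_Ropp, (Rabs_pos_eq u) by lra. lra.
  - intros u Hu. apply (is_derive_opp (V := R_NormedModule)).
    apply (is_derive_mult (K := R_AbsRing) (fun t => moment1 mu eps t - t) (fun t => Rpower t (- (1 / 2)))).
    + apply (is_derive_minus (V := R_NormedModule) (moment1 mu eps) (fun t => t)).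
      now apply is_derive_moment1. apply (is_derive_id (K := R_AbsRing) u).
    + now apply is_derive_Rpower.
    + intros; apply Rmult_comm.
  - intros u Hu. specialize (H u Hu).
    assert (P : 0 < Rpower u (- (1 / 2) - 1)) by apply exp_pos.
    replace (Rpower u (- (1 / 2))) with (Rpower u (- (1 / 2) - 1) * u).
    2:{ rewrite <- (Rpower_1 u) at 2 by lra. rewrite <- Rpower_plus. f_equal. field. }
    replace (- ((D mu eps u / u - 1) * (Rpower u (- (1 / 2) - 1) * u)
      + (moment1 mu eps u - u) * (- (1 / 2) * Rpower u (- (1 / 2) - 1))))
    with (Rpower u (- (1 / 2) - 1) * ((moment1 mu eps u - (2 * D mu eps u - u)) / 2)) by (field; lra).
    apply Rmult_le_pos; lra. }
(* Yet m1 >= D > t makes [f (1 / 2)] negative. *)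
unfold f in Hf. assert (P : 0 < Rpower (1 / 2) (- (1 / 2))) by apply exp_pos.
generalize (moment1_ge_D mu eps (1 / 2) Hmu He ltac:(lra)) (D_bounds mu eps (1 / 2) Hmu He ltac:(lra)). nra.
Qed.

Lemma diag_crit_pos (mu eps : R) : 0 < mu -> 0 < eps < 1 ->
  exists t, 0 < t < 1 /\ 0 < diag_crit mu eps t.
Proof.
intros Hmu He. destruct (exists_moment1_lt mu eps Hmu He) as [t [Ht H]].
exists t. split; [exact Ht|].
assert (H1 := moment1_ge_D mu eps t Hmu He Ht). assert (H2 := moment2_ge_moment1 mu eps t Hmu He Ht).
assert (H3 := D_bounds mu eps t Hmu He Ht).
unfold diag_crit. set (a := moment1 mu eps t) in *. set (c := moment2 mu eps t) in *. set (d := D mu eps t) in *.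
assert (0 <= (d - t) * (c - 2 * a)) by (apply Rmult_le_pos; lra).
assert (0 <= t * a * (a - d)) by (apply Rmult_le_pos; [apply Rmult_le_pos|]; lra).
assert (0 < a * (2 * d - t - a)) by (apply Rmult_lt_0_compat; lra).
replace ((d - t) * (c - a ^ 2) - (a - t) * (1 - d) * a) with
  ((d - t) * (c - 2 * a) + t * a * (a - d) + a * (2 * d - t - a)) by ring.
lra.
Qed.

(** * Behaviour at the right endpoint *)

(** The 1 here and the 2 in [g_tilde_2_eq] are the first two moments of -ln U for uniform U. Thus 1
    + g1 = 2 - L, which is why the mean is compared with 2. *)
Lemma g_tilde_1_eq (mu L : R) : 0 < mu ->
  filterlim (lik_log mu) (at_left 1) (locally L) -> g_tilde 1 mu = 1 - L.
Proof.
intros Hmu HL. unfold g_tilde. apply is_RInt_gen_unique.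
destruct (lik_log_spec mu Hmu) as [C [Hd [Hb _]]].
replace (1 - L) with (- L - (1 * ln 1 - 1) - (0 - 0)) by (rewrite ln_1; ring).
apply (is_RInt_gen_primitive_open_unit (at_right 0) (at_left 1) _ _ _
  (fun t => - lik_log mu t - (t * ln t - t))).
- apply at_right_0_open_unit.
- apply at_left_1_open_unit.
- intros u Hu. fold (lik mu u). evar_last.
  apply (is_derive_minus (V := R_NormedModule) (fun t => - lik_log mu t) (fun t => t * ln t - t)).
  apply (is_derive_opp (V := R_NormedModule)), Hd, Hu.
  apply is_derive_mul_ln, Hu.
  unfold minus, plus, opp; simpl. ring.
- intros u Hu.
  apply (continuous_mult (K := R_AbsRing) (fun u => ln u ^ 1) (fun u => lik mu u - 1)).
  + apply (ex_derive_continuous (K := R_AbsRing) (V := R_NormedModule)). auto_derive; apply Hu.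
  + apply (continuous_minus (V := R_NormedModule) (lik mu) (fun _ => 1)).
    now apply continuous_lik. apply continuous_const.
- apply filterlim_Rminus; [typeclasses eauto | |].
  + apply filterlim_0_of_Rpower_bound with C (3 / 4); [lra|]. intros u Hu.
    specialize (Hb u Hu). rewrite Rabs_Ropp, Rabs_pos_eq; lra.
  + apply filterlim_0_of_Rpower_bound with 514 (3 / 4); [lra | apply mul_ln_abs_le].
- apply filterlim_Rminus; [typeclasses eauto | |].
  + apply filterlim_Ropp; [typeclasses eauto | exact HL].
  + apply (filterlim_at_left_continuous (fun t => t * ln t - t)).
    apply (ex_derive_continuous (K := R_AbsRing) (V := R_NormedModule)).
    eexists; apply is_derive_mul_ln; lra.
Qed.

Lemma g_tilde_2_eq (mu L : R) : 0 < mu ->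
  filterlim (lik_log2 mu) (at_left 1) (locally L) -> g_tilde 2 mu = L - 2.
Proof.
intros Hmu HL. unfold g_tilde. apply is_RInt_gen_unique.
destruct (lik_log2_spec mu Hmu) as [C [Hd [Hb _]]].
replace (L - 2) with (L - (1 * ln 1 ^ 2 - 2 * 1 * ln 1 + 2 * 1) - (0 - 0)) by (rewrite ln_1; ring).
apply (is_RInt_gen_primitive_open_unit (at_right 0) (at_left 1) _ _ _
  (fun t => lik_log2 mu t - (t * ln t ^ 2 - 2 * t * ln t + 2 * t))).
- apply at_right_0_open_unit.
- apply at_left_1_open_unit.
- intros u Hu. fold (lik mu u). evar_last.
  apply (is_derive_minus (V := R_NormedModule) (lik_log2 mu) (fun t => t * ln t ^ 2 - 2 * t * ln t + 2 * t)).
  apply Hd, Hu.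
  apply is_derive_mul_ln2, Hu.
  unfold minus, plus, opp; simpl. ring.
- intros u Hu.
  apply (continuous_mult (K := R_AbsRing) (fun u => ln u ^ 2) (fun u => lik mu u - 1)).
  + apply (ex_derive_continuous (K := R_AbsRing) (V := R_NormedModule)). auto_derive; apply Hu.
  + apply (continuous_minus (V := R_NormedModule) (lik mu) (fun _ => 1)).
    now apply continuous_lik. apply continuous_const.
- apply filterlim_Rminus; [typeclasses eauto | |].
  + apply filterlim_0_of_Rpower_bound with C (3 / 4); [lra|]. intros u Hu.
    specialize (Hb u Hu). rewrite Rabs_pos_eq; lra.
  + apply filterlim_0_of_Rpower_bound with 771 (3 / 4); [lra | apply mul_ln2_abs_le].
- apply filterlim_Rminus; [typeclasses eauto | exact HL |].
  apply (filterlim_at_left_continuous (fun t => t * ln t ^ 2 - 2 * t * ln t + 2 * t)).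
  apply (ex_derive_continuous (K := R_AbsRing) (V := R_NormedModule)).
  eexists; apply is_derive_mul_ln2; lra.
Qed.

(** This limit stands for the derivative of [D] at 1. By concavity the signal part of the ratio lies
    between 0 and [eps * lik mu t], which tends to 0. *)
Lemma filterlim_D_complement_ratio (mu eps : R) : 0 < mu -> 0 < eps < 1 ->
  filterlim (fun t => (1 - D mu eps t) / (1 - t)) (at_left 1) (locally (1 - eps)).
Proof.
intros Hmu He.
apply (filterlim_le_le (fun _ => 1 - eps) _ (fun t => 1 - eps + eps * lik mu t) (1 - eps)).
- generalize at_left_1_open_unit. apply filter_imp. intros t Ht.
  assert (H1 := alt_cdf_concave_1 mu t Hmu Ht). assert (H2 := alt_cdf_gt mu t Hmu Ht).
  assert (E : 1 - D mu eps t = (1 - eps) * (1 - t) + eps * (1 - alt_cdf mu t)).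
  { unfold D. fold (alt_cdf mu t). ring. }
  rewrite E. split; apply Rmult_le_reg_r with (1 - t); try lra;
    unfold Rdiv; rewrite Rmult_assoc, Rinv_l by lra; nra.
- apply filterlim_const.
- replace (Rbar_locally (1 - eps)) with (locally (1 - eps + eps * 0)).
  2:{ now rewrite Rmult_0_r, Rplus_0_r. }
  apply filterlim_Rplus; [typeclasses eauto | apply filterlim_const |].
  apply filterlim_Rmult; [typeclasses eauto | apply filterlim_const | now apply filterlim_lik_1].
Qed.

Lemma filterlim_ln_1 : filterlim ln (at_left 1) (locally 0).
Proof.
rewrite <- ln_1. apply filterlim_at_left_continuous, continuous_ln. lra.
Qed.

Lemma filterlim_D_1 (mu eps : R) : filterlim (D mu eps) (at_left 1) (locally 1).
Proof.
replace (locally 1) with (locally ((1 - eps) * 1 + eps * 1)) by (f_equal; ring).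
apply (filterlim_Rplus (at_left 1) (fun t => (1 - eps) * t) (fun t => eps * alt_cdf mu t)).
- apply (filterlim_at_left_continuous (fun t => (1 - eps) * t)).
  apply (ex_derive_continuous (K := R_AbsRing) (V := R_NormedModule)). auto_derive; easy.
- apply filterlim_Rmult; [typeclasses eauto | apply filterlim_const | apply filterlim_alt_cdf_1].
Qed.

Lemma filterlim_mix_log_1 (mu eps L1 : R) :
  filterlim (lik_log mu) (at_left 1) (locally L1) ->
  filterlim (mix_log mu eps) (at_left 1) (locally (- (1 - eps + eps * L1))).
Proof.
intros HL1.
replace (locally (- (1 - eps + eps * L1))) with (locally ((1 - eps) * (1 * ln 1 - 1) + eps * - L1))
  by (rewrite ln_1; f_equal; ring).
apply filterlim_Rplus; [typeclasses eauto | |].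
- apply filterlim_Rmult; [typeclasses eauto | apply filterlim_const |].
  apply (filterlim_at_left_continuous (fun t => t * ln t - t)).
  apply (ex_derive_continuous (K := R_AbsRing) (V := R_NormedModule)).
  eexists; apply is_derive_mul_ln; lra.
- apply filterlim_Rmult; [typeclasses eauto | apply filterlim_const |].
  apply filterlim_Ropp; [typeclasses eauto | exact HL1].
Qed.

Lemma filterlim_mix_log2_1 (mu eps L2 : R) :
  filterlim (lik_log2 mu) (at_left 1) (locally L2) ->
  filterlim (mix_log2 mu eps) (at_left 1) (locally (2 * (1 - eps) + eps * L2)).
Proof.
intros HL2.
replace (locally (2 * (1 - eps) + eps * L2))
  with (locally ((1 - eps) * (1 * ln 1 ^ 2 - 2 * 1 * ln 1 + 2 * 1) + eps * L2))
  by (rewrite ln_1; f_equal; ring).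
apply filterlim_Rplus; [typeclasses eauto | |].
- apply filterlim_Rmult; [typeclasses eauto | apply filterlim_const |].
  apply (filterlim_at_left_continuous (fun t => t * ln t ^ 2 - 2 * t * ln t + 2 * t)).
  apply (ex_derive_continuous (K := R_AbsRing) (V := R_NormedModule)).
  eexists; apply is_derive_mul_ln2; lra.
- apply filterlim_Rmult; [typeclasses eauto | apply filterlim_const | exact HL2].
Qed.

Lemma filterlim_moment1_1 (mu eps L1 : R) :
  filterlim (lik_log mu) (at_left 1) (locally L1) ->
  filterlim (moment1 mu eps) (at_left 1) (locally (1 - eps + eps * L1)).
Proof.
intros HL1.
replace (locally (1 - eps + eps * L1)) with (locally (0 * 1 - - (1 - eps + eps * L1))) by (f_equal; ring).
apply filterlim_Rminus; [typeclasses eauto | | now apply filterlim_mix_log_1].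
apply filterlim_Rmult; [typeclasses eauto | apply filterlim_ln_1 | apply filterlim_D_1].
Qed.

Lemma filterlim_moment2_1 (mu eps L1 L2 : R) :
  filterlim (lik_log mu) (at_left 1) (locally L1) ->
  filterlim (lik_log2 mu) (at_left 1) (locally L2) ->
  filterlim (moment2 mu eps) (at_left 1) (locally (2 * (1 - eps) + eps * L2)).
Proof.
intros HL1 HL2.
replace (locally (2 * (1 - eps) + eps * L2))
  with (locally (0 * (0 * 1) * 1 - 2 * 0 * - (1 - eps + eps * L1) + (2 * (1 - eps) + eps * L2)))
  by (f_equal; ring).
apply filterlim_Rplus; [typeclasses eauto | | now apply filterlim_mix_log2_1].
apply filterlim_Rminus; [typeclasses eauto | |].
- apply filterlim_Rmult; [typeclasses eauto | | apply filterlim_D_1].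
  apply filterlim_Rmult; [typeclasses eauto | apply filterlim_ln_1 |].
  apply filterlim_Rmult; [typeclasses eauto | apply filterlim_ln_1 | apply filterlim_const].
- apply filterlim_Rmult; [typeclasses eauto | | now apply filterlim_mix_log_1].
  apply filterlim_Rmult; [typeclasses eauto | apply filterlim_const | apply filterlim_ln_1].
Qed.

(** Both terms of [diag_crit] vanish to first order at 1: 1 - D is equivalent to (1 - eps)(1 - t),
    and D - t = (1 - t) - (1 - D) to eps (1 - t). *)
Lemma filterlim_diag_crit_1 (mu eps L1 L2 : R) :
  0 < mu -> 0 < eps < 1 ->
  filterlim (lik_log mu) (at_left 1) (locally L1) ->
  filterlim (lik_log2 mu) (at_left 1) (locally L2) ->
  let M1 := 1 - eps + eps * L1 in
  let M2 := 2 * (1 - eps) + eps * L2 in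
  filterlim (fun t => diag_crit mu eps t / (1 - t)) (at_left 1)
    (locally (eps * (M2 - M1 ^ 2) - (M1 - 1) * (1 - eps) * M1)).
Proof.
intros Hmu He HL1 HL2 M1 M2.
assert (H1 : filterlim (moment1 mu eps) (at_left 1) (locally M1)) by now apply filterlim_moment1_1.
assert (H2 : filterlim (moment2 mu eps) (at_left 1) (locally M2)) by now apply (filterlim_moment2_1 mu eps L1 L2).
assert (H3 := filterlim_D_complement_ratio mu eps Hmu He).
assert (Hid : filterlim (fun t : R => t) (at_left 1) (locally 1)).
{ apply (filterlim_at_left_continuous (fun t => t)), continuous_id. }
apply (filterlim_ext_loc (fun t => (1 - (1 - D mu eps t) / (1 - t)) * (moment2 mu eps t - moment1 mu eps t * moment1 mu eps t)
  - (moment1 mu eps t - t) * ((1 - D mu eps t) / (1 - t)) * moment1 mu eps t)).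
- generalize at_left_1_open_unit. apply filter_imp. intros t Ht. unfold diag_crit. field. lra.
- replace (eps * (M2 - M1 ^ 2) - (M1 - 1) * (1 - eps) * M1)
   with ((1 - (1 - eps)) * (M2 - M1 * M1) - (M1 - 1) * (1 - eps) * M1) by ring.
  repeat first [assumption | apply filterlim_const
    | apply filterlim_Rminus; [typeclasses eauto | |] | apply filterlim_Rmult; [typeclasses eauto | |]].
Qed.
Lemma diag_crit_neg_near_1 (mu eps a : R) : 0.85 < mu -> 0 < eps < 1 -> eps < h_b mu -> a < 1 ->
  exists t, a < t < 1 /\ 0 < t /\ diag_crit mu eps t < 0.
Proof.
intros Hmu He Hh Ha.
destruct (lik_log_spec mu ltac:(lra)) as [C1 [_ [_ [L1 HL1]]]].
destruct (lik_log2_spec mu ltac:(lra)) as [C2 [_ [_ [L2 HL2]]]].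
assert (G1 := g_tilde_1_eq mu L1 ltac:(lra) HL1).
assert (G2 := g_tilde_2_eq mu L2 ltac:(lra) HL2).
assert (HL := lik_log_lim_gt_2 mu L1 Hmu HL1).
assert (Hlim := filterlim_diag_crit_1 mu eps L1 L2 ltac:(lra) He HL1 HL2). cbv zeta in Hlim.
unfold h_b in Hh. rewrite G1, G2 in Hh.
set (den := (1 - L1) ^ 2 - (1 - L1) - (L2 - 2)) in Hh.
(* For [den >= 0] the quotient [h_b mu] would be nonpositive; at [den = 0] because [x / 0 = 0]. *)
assert (Hden : den < 0).
{ apply Rnot_le_lt. intros N. destruct N as [N|N].
  - assert ((1 + (1 - L1)) / den < 0); [|lra].
    unfold Rdiv. apply Rmult_neg_pos; [lra | now apply Rinv_0_lt_compat].
  - rewrite <- N in Hh. unfold Rdiv in Hh. rewrite Rinv_0, Rmult_0_r in Hh. lra. }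
(* Multiplying [eps < h_b mu] by the negative denominator reverses the inequality. *)
assert (Hneg : 1 + (1 - L1) - eps * den < 0).
{ assert (X : (1 + (1 - L1)) / den * den < eps * den) by nra.
  unfold Rdiv in X. rewrite Rmult_assoc, Rinv_l in X by lra. lra. }
match type of Hlim with filterlim _ _ (locally ?l) => set (lim := l) in Hlim end.
assert (Hl : lim < 0).
{ replace lim with (eps * (1 + (1 - L1) - eps * den)) by (unfold lim, den; ring). nra. }
assert (Hev : at_left 1 (fun t => diag_crit mu eps t / (1 - t) < 0)).
{ apply (Hlim (fun y => y < 0)). apply open_lt, Hl. }
assert (Hall := filter_and _ _ Hev (filter_and _ _ (at_left_gt a 1 Ha) at_left_1_open_unit)).
destruct (filter_ex _ Hall) as [t [Ht1 [Ht2 Ht3]]].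
exists t. repeat split; try lra.
assert (P : 0 < 1 - t) by lra.
replace (diag_crit mu eps t) with (diag_crit mu eps t / (1 - t) * (1 - t)) by (field; lra).
nra.
Qed.

(** * The root of [diag_crit] and the stationary point *)

Lemma continuous_diag_crit (mu eps t : R) : 0 < mu -> 0 < t < 1 -> continuous (diag_crit mu eps) t.
Proof.
intros Hmu Ht. apply (ex_derive_continuous (K := R_AbsRing) (V := R_NormedModule)).
assert (HD : ex_derive (D mu eps) t) by (eexists; now apply is_derive_D).
assert (H1 : ex_derive (moment1 mu eps) t) by (eexists; now apply is_derive_moment1).
assert (H2 : ex_derive (moment2 mu eps) t) by (eexists; now apply is_derive_moment2).
unfold diag_crit. auto_derive. repeat split;
  match goal with
  | |- ex_derive (fun x => D _ _ x) _ => exact HD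
  | |- ex_derive (fun x => moment1 _ _ x) _ => exact H1
  | |- ex_derive (fun x => moment2 _ _ x) _ => exact H2
  end.
Qed.

Lemma exists_diag_crit_root (mu eps : R) : 0.85 < mu -> 0 < eps < 1 -> eps < h_b mu ->
  exists t, 0 < t < 1 /\ diag_crit mu eps t = 0.
Proof.
intros Hmu He Hh.
destruct (diag_crit_pos mu eps ltac:(lra) He) as [a [Ha Hpos]].
destruct (diag_crit_neg_near_1 mu eps a Hmu He Hh (proj2 Ha)) as [c [Hc [_ Hneg]]].
destruct (Ranalysis5.IVT_interv (fun t => - diag_crit mu eps t) a c) as [t [Ht E]]; try lra.
- intros t Ht. apply continuity_pt_opp, continuity_pt_filterlim, continuous_diag_crit; lra.
- exists t. lra.
Qed.

Theorem theorem2 (mu eps : R) :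
  0 < mu -> 0 < eps < 1 -> 0.85 < mu -> eps < h_b mu ->
  exists ts : R, 0 < ts < 1 /\
    is_derive (fun t1 => b mu eps t1 ts) ts 0 /\
    is_derive (fun t2 => b mu eps ts t2) ts 0.
Proof.
intros Hmu0 He Hmu Hh.
destruct (exists_diag_crit_root mu eps Hmu He Hh) as [t [Ht E]].
exists t. split; [exact Ht|].
assert (HV := variance_pos mu eps t Hmu0 He Ht).
assert (HD := is_derive_D mu eps t Ht).
assert (H1 := is_derive_mix_log mu eps t Hmu0 Ht).
assert (H2 := is_derive_mix_log2 mu eps t Hmu0 Ht).
unfold diag_crit, moment1, moment2 in E. unfold moment1, moment2 in HV.
split.
- apply is_derive_ext_loc with (fun t1 =>
    (ln t * D mu eps t1 - mix_log mu eps t1 - t1 * (1 - ln t1 + ln t)) /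
    sqrt (mix_log2 mu eps t1 - mix_log mu eps t1 ^ 2
        + 2 * (D mu eps t1 - 1) * ln t * mix_log mu eps t1
        + ln t ^ 2 * D mu eps t1 * (1 - D mu eps t1))).
  { generalize (locally_open_interval 0 1 t Ht). apply filter_imp.
    intros y Hy. symmetry. apply b_eq; lra. }
  (* Both derivatives in t1 carry the factor [ln t - ln t1], the value of the integrand at its
     endpoint, which is 0 at t1 = t. *)
  apply is_derive_div_sqrt_0 with 0 0.
  + auto_derive.
    * repeat split; try lra; eexists; eassumption.
    * replace (Derive (fun x : R => D mu eps x) t) with (mix_dens mu eps t) by (symmetry; apply is_derive_unique, HD).
      replace (Derive (fun x : R => mix_log mu eps x) t) with (ln t * mix_dens mu eps t) by (symmetry; apply is_derive_unique, H1).
      field. lra.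
  + auto_derive.
    * repeat split; eexists; eassumption.
    * replace (Derive (fun x : R => D mu eps x) t) with (mix_dens mu eps t) by (symmetry; apply is_derive_unique, HD).
      replace (Derive (fun x : R => mix_log mu eps x) t) with (ln t * mix_dens mu eps t) by (symmetry; apply is_derive_unique, H1).
      replace (Derive (fun x : R => mix_log2 mu eps x) t) with (ln t ^ 2 * mix_dens mu eps t) by (symmetry; apply is_derive_unique, H2).
      ring.
  + lra.
  + field.
- apply is_derive_ext_loc with (fun t2 =>
    (ln t2 * D mu eps t - mix_log mu eps t - t * (1 - ln t + ln t2)) /
    sqrt (mix_log2 mu eps t - mix_log mu eps t ^ 2
        + 2 * (D mu eps t - 1) * ln t2 * mix_log mu eps t
        + ln t2 ^ 2 * D mu eps t * (1 - D mu eps t))).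
  { generalize (locally_open_interval 0 1 t Ht). apply filter_imp.
    intros y Hy. symmetry. apply b_eq; lra. }
  apply is_derive_div_sqrt_0 with ((D mu eps t - t) / t)
    (2 * (1 - D mu eps t) * (ln t * D mu eps t - mix_log mu eps t) / t).
  + auto_derive; [lra | field; lra].
  + auto_derive; [lra | field; lra].
  + lra.
  (* On the diagonal the numerator of [b] is m1 - t; once 1/t is cleared, the criterion is exactly
     [diag_crit mu eps t = 0]. *)
  + apply Rmult_eq_reg_r with t; [|lra].
    match goal with |- ?a = ?c => assert (X : a - c = 0); [|lra] end.
    rewrite <- E. field. lra.
Qed.
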